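(* Let $(X,d,\mathfrak m)$ be a metric measure space and let $p\in[1,\infty)$. Let $r\in[1,\infty]$, let $f:X\to\mathbb R$ be a Borel function with $\int|f|^p\,d\mathfrak m<\infty$, and let $\rho:X\to[0,\infty]$ be a Borel function with $\int\rho^p\,d\mathfrak m<\infty$. Define $$\Gamma^r_{f,\rho}=\Big\{\gamma\in AC^r([0,1];X)\;:\;|f(\gamma_1)-f(\gamma_0)|>\int_\gamma\rho\,ds\Big\}.$$ If $\mathrm{Mod}^1_p(\Gamma^r_{f,\rho})>0$, then there exist a compact family $\Gamma\subseteq\Gamma^r_{f,\rho}$ (compact in $C([0,1];X)$) and $k>0$ such that $$0<\mathrm{Mod}^1_p(\Gamma)<+\infty\qquad\text{and}\qquad \Gamma\subseteq\{\gamma\in\mathrm{LIP}([0,1];X):\ \mathrm{Lip}(\gamma)\le k\}.$$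
   Context: A metric measure space $(X,d,\mathfrak m)$ is a complete separable metric space with a non-negative Borel measure $\mathfrak m$ finite on bounded sets. $C([0,1];X)$ has the supremum distance. $AC^r([0,1];X)$ is the set of $\gamma\in C([0,1];X)$ for which there is a non-negative $g\in L^r(0,1)$ with $d(\gamma_s,\gamma_t)\le\int_s^tg\,d\tau$ for all $0\le s<t\le1$. $\mathrm{LIP}([0,1];X)$ is the set of Lipschitz curves and $\mathrm{Lip}(\gamma)$ the Lipschitz constant. For a curve $\gamma:[a_\gamma,b_\gamma]\to X$ of finite length $\ell(\gamma)$, $s_\gamma$ is the Borel measure on $[a_\gamma,b_\gamma]$ with $s_\gamma([s,t])=\ell(\gamma|_{[s,t]})$, and $\int_\gamma\rho\,ds=\int\rho\circ\gamma\,ds_\gamma$ for Borel $\rho\ge0$; if $\ell(\gamma)=\infty$ then $\int_\gamma\rho\,ds=+\infty$. For a family $\Gamma$ of continuous curves defined on compact intervals, $\mathrm{Mod}^1_p(\Gamma)$ is the infimum of $\int\rho^p\,d\mathfrak m$ over all Borel $\rho:X\to[0,\infty]$ with $\rho(\gamma_{a_\gamma})+\rho(\gamma_{b_\gamma})+\int_\gamma\rho\,ds\ge1$ for every $\gamma\in\Gamma$. *)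

(* Defs.v *)
From HB Require Import structures.
From mathcomp Require Import all_boot all_order all_algebra.
From mathcomp Require Import all_classical all_reals all_analysis.
From mathcomp Require Import measurable_realfun.

Set Implicit Arguments.
Unset Strict Implicit.
Unset Printing Implicit Defensive.

Import Order.TTheory GRing.Theory Num.Theory.
Import numFieldNormedType.Exports.

Local Open Scope classical_set_scope.
Local Open Scope ring_scope.

(* [Complete] includes a base point, which the library requires of every
   measurable space as well. *)
#[short(type="completeMetricType")]
HB.structure Definition CompleteMetric (R : numDomainType) :=
  {T of Metric R T & Complete T}.

Definition separable (X : topologicalType) : Prop :=
  exists2 S : set X, countable S & dense S.

Notation borel X := (g_sigma_algebraType (@open X)).

Definition metric_bounded (R : realType) (X : metricType R) (A : set X) : Prop :=
  exists M : R, forall x y, A x -> A y -> mdist x y <= M.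

Definition finite_on_bounded (R : realType) (X : completeMetricType R)
    (mu : {measure set (borel X) -> \bar R}) : Prop :=
  forall A : set (borel X), measurable A -> metric_bounded (A : set X) ->
    (mu A < +oo)%E.

Section curves.
Context {R : realType} {X : completeMetricType R}.
Implicit Types (a b : R) (g : R -> X).

(* A curve on [a, b] is given by a function on the whole line, of which only
   the values on [a, b] matter. *)
Record curve := Curve {
  curve_lo : R;
  curve_hi : R;
  curve_fun :> R -> X;
  curve_le : curve_lo <= curve_hi;
  curve_cont : {within `[curve_lo, curve_hi], continuous curve_fun}
}.

Definition curve_length a b g : \bar R :=
  ereal_sup [set (\sum_(0 <= n < size s)
      mdist (g (nth b (a :: s) n)) (g (nth b (a :: s) n.+1)))%:E
    | s in [set s | itv_partition a b s]].

Definition is_arc_measure a b g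
    (nu : {measure set (measurableTypeR R) -> \bar R}) : Prop :=
  forall s t, a <= s -> s <= t -> t <= b -> nu `[s, t]%classic = curve_length s t g.

(* The measure s_g. For a continuous g of finite length on [a, b] a measure as
   in [is_arc_measure] exists, and its restriction to [a, b] is unique; the
   default value [mzero] is irrelevant. *)
Definition arc_measure a b g : {measure set (measurableTypeR R) -> \bar R} :=
  match pselect (exists nu, is_arc_measure a b g nu) with
  | left h => projT1 (cid h)
  | right _ => mzero
  end.

Definition line_integral a b g (rho : X -> \bar R) : \bar R :=
  if curve_length a b g == +oo%E then +oo%E
  else (\int[arc_measure a b g]_(t in `[a, b]) rho (g t))%E.

Definition C01 : set (R -> X) :=
  [set g : R -> X | {within `[(0 : R), 1], continuous g}].

Definition AC01 (r : \bar R) : set (R -> X) := [set g | C01 g /\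
  exists h : measurableTypeR R -> R,
    [/\ forall t, 0 <= h t,
        h \in Lfun (mrestr (@lebesgue_measure R) (measurable_itv `](0 : R), 1[)) r &
        forall s t, 0 <= s -> s < t -> t <= 1 ->
          ((mdist (g s) (g t))%:E <=
             \int[@lebesgue_measure R]_(x in `[s, t]) (h x)%:E)%E]].

Definition lip01 g : \bar R :=
  ereal_sup [set (mdist (g st.1) (g st.2) / `|st.1 - st.2|)%:E
    | st in [set st : R * R | [/\ 0 <= st.1 <= 1, 0 <= st.2 <= 1 &
                                  st.1 != st.2]]].

Definition LIP01 : set (R -> X) := [set g | (lip01 g < +oo)%E].

(* Compactness in C([0,1];X) for the supremum distance, i.e. for uniform
   convergence on [0, 1]. Functions that agree on [0, 1] are topologically
   indistinguishable in this space, so G is compact here if and only if the set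
   of the restrictions to [0, 1] of its elements is. *)
Definition compact01 (G : set (R -> X)) : Prop :=
  compact (G : set {uniform` `[(0 : R), 1]%classic -> X}).

Definition curves01 (G : set (R -> X)) : set curve :=
  [set c | [/\ curve_lo c = 0, curve_hi c = 1 & G c]].

Definition admissible (G : set curve) (rho : borel X -> \bar R) : Prop :=
  [/\ measurable_fun setT rho,
      forall x, (0 <= rho x)%E &
      forall c, G c ->
        (1 <= rho (c (curve_lo c)) + rho (c (curve_hi c))
              + line_integral (curve_lo c) (curve_hi c) c rho)%E].

Definition Mod1 (mu : {measure set (borel X) -> \bar R}) (p : R)
    (G : set curve) : \bar R :=
  ereal_inf [set (\int[mu]_x (rho x `^ p))%E | rho in admissible G].

Definition bad_curves (r : \bar R) (f : X -> R) (rho : X -> \bar R) :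
    set (R -> X) :=
  [set g | AC01 r g /\ (line_integral 0 1 g rho < `|f (g 1) - f (g 0)|%:E)%E].

End curves.
Arguments curve {R} X.

(* Main.v *)
Require Import Defs.
From HB Require Import structures.
From mathcomp Require Import all_boot all_order all_algebra.
From mathcomp Require Import all_classical all_reals all_analysis.
From mathcomp Require Import measurable_realfun.
From mathcomp Require Import ring lra.

(** The idea is to cover the bad curves, up to a family of modulus zero and up to
    reparametrization, by countably many compact families of bad curves. As a
    countable union of families of modulus zero has modulus zero
    ([Mod1_eq0_bigcup]), one of the compact families has positive modulus.

    Two reductions come first. A bad curve belongs, for some [L], to the bad
    curves of length at most [L] that start at distance at most [L] from a fixed
    point; these stay in a ball [B] of finite measure. Parametrized with constant
    speed, they become [L]-Lipschitz and keep their end points and their line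
    integrals ([constant_speed]). Line integrals make sense here because the arc
    measure of a curve with continuous length is a Stieltjes measure, unique on
    [0, 1].

    Bad curves are defined by a strict inequality, with a Borel function [rho] and
    a Borel function [f]; neither survives a uniform limit. For a small [d > 0],
    the function [rho] is at most [d * \sum_k \1_(E k)] with [E k] the level set
    [rho > k * d], and this sum is at most [rho + d]. Regularity of finite Borel
    measures, Ulam's theorem and Lusin's theorem ([compact_open_approximation])
    give open sets [V k] and compact sets [K k] such that [V k] contains [E k]
    and the complement of [K k], [f] is continuous on [K k], and [V k] exceeds
    [E k] by a set [D k] which also contains the complement of [K k] and which is
    as small as desired. Do this for every [d = 1 / j.+1], with sets [D j k] so
    small that the supremum [h] over [j] of [\sum_k \1_(D j k)] is in L^p. On [B],

      rho <= d * \sum_k \1_(V j k) <= rho + d * (1 + h).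

    The curves on which [h] has an infinite integral, or an infinite value at an
    end point, have modulus zero ([Mod1_eq0_infinite]). Along any other curve the
    middle term, the majorant, costs more than [rho] by at most [d] times a
    constant that depends on the curve only, and the end points lie in [K j k] for
    all large [k]. So for suitable [j] and [k] the curve belongs to the family of
    the Lipschitz curves with end points in [K j k] whose majorant integral is at
    most [`|f (g 1) - f (g 0)| - d] ([bounded_part_cover]).

    These families are compact ([tight_family_compact]). They are closed, because
    [f] is continuous on [K j k] and the length of a curve inside an open set is
    lower semicontinuous under uniform convergence ([length_in_lsc]). They are
    tight, because the bound on the majorant bounds the sum over [l] of the
    lengths outside [K j l], so that each curve has little length outside one of
    the first few of these compact sets. Arzela-Ascoli concludes. *)

Set Implicit Arguments.
Unset Strict Implicit.
Unset Printing Implicit Defensive.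

Import Order.TTheory GRing.Theory Num.Theory.
Import numFieldNormedType.Exports.

Local Open Scope classical_set_scope.
Local Open Scope ring_scope.

(** * Length of curves in a metric space *)

Section length.
Context {R : realType} {X : completeMetricType R}.
Implicit Types (a b c s t : R) (g : R -> X) (l : seq R).

(** The sums in [curve_length], in a form suited to induction on the partition. *)
Fixpoint polygon_length g a l : R :=
  if l is x :: l' then mdist (g a) (g x) + polygon_length g x l' else 0.

Lemma polygon_lengthE g a b l :
  \sum_(0 <= n < size l)
    mdist (g (nth b (a :: l) n)) (g (nth b (a :: l) n.+1)) = polygon_length g a l.
Proof.
elim: l a => [|x l ih] a /=; first by rewrite big_geq.
by rewrite big_nat_recl//= ih.
Qed.

Lemma polygon_length_cat g a l l' :
  polygon_length g a (l ++ l') =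
  polygon_length g a l + polygon_length g (last a l) l'.
Proof. by elim: l a => [|x l ih] a /=; rewrite ?add0r// ih addrA. Qed.

Lemma polygon_length_le g a b l : itv_partition a b l ->
  ((polygon_length g a l)%:E <= curve_length a b g)%E.
Proof.
by move=> abl; apply: ereal_sup_ubound; exists l => //; rewrite polygon_lengthE.
Qed.

Lemma curve_length_le g a b (u : \bar R) :
  (forall l, itv_partition a b l -> (polygon_length g a l)%:E <= u)%E ->
  (curve_length a b g <= u)%E.
Proof.
by move=> h; apply: ge_ereal_sup => _ [l /= abl <-]; rewrite polygon_lengthE h.
Qed.

Lemma mdist_le_curve_length g a b : a <= b ->
  ((mdist (g a) (g b))%:E <= curve_length a b g)%E.
Proof.
rewrite le_eqVlt => /predU1P[<-|ab].
  rewrite mdistxx; apply: (@polygon_length_le g a a [::]).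
  by split => //=.
have := polygon_length_le g (itv_partition1 ab).
by rewrite /= addr0.
Qed.

Lemma curve_length_ge0 g a b : a <= b -> (0 <= curve_length a b g)%E.
Proof.
by move=> /(mdist_le_curve_length g); apply: le_trans; rewrite lee_fin mdist_ge0.
Qed.

(** Induction on the partition. All the upper bounds on lengths come from here,
    with [F s t] the increment of a function, or a length of another curve. *)
Lemma curve_length_le_superadditive g a b (F : R -> R -> \bar R) :
  (forall s, a <= s -> s <= b -> (0 <= F s s)%E) ->
  (forall s t, a <= s -> s < t -> t <= b -> ((mdist (g s) (g t))%:E <= F s t)%E) ->
  (forall s t u, a <= s -> s < t -> t <= u -> u <= b ->
     (F s t + F t u <= F s u)%E) ->
  (curve_length a b g <= F a b)%E.
Proof.
move=> F0 Fd FD; apply: curve_length_le => l.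
suff H s : a <= s -> itv_partition s b l ->
  ((polygon_length g s l)%:E <= F s b)%E by exact: H.
elim: l s => [|x l ih] s as_ sl /=.
  by rewrite (itv_partition_nil sl) in as_ *; apply: F0.
have sx : s < x by case: sl => /= /andP[].
have xl := itv_partition_cons sl.
have xb := itv_partition_le xl.
rewrite EFinD; apply: le_trans (FD s x b as_ sx xb (lexx b)).
apply: leeD; first exact: Fd.
by apply: ih => //; exact: (le_trans as_ (ltW sx)).
Qed.

Lemma curve_length_superadditive g a b c : a <= b -> b <= c ->
  (curve_length a b g + curve_length b c g <= curve_length a c g)%E.
Proof.
move=> ab bc.
have [->|ac] := eqVneq (curve_length a c g) +oo%E; first by rewrite leey.
have H l l' : itv_partition a b l -> itv_partition b c l' ->
    ((polygon_length g a l)%:E + (polygon_length g b l')%:E <= curve_length a c g)%E.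
  move=> abl bcl; rewrite -EFinD.
  apply: le_trans (polygon_length_le g (itv_partition_cat abl bcl)).
  rewrite lee_fin polygon_length_cat.
  by case: abl => _ /eqP ->.
have acf : curve_length a c g \is a fin_num.
  by rewrite ge0_fin_numE ?lt_neqAle ?ac ?leey// curve_length_ge0// (le_trans ab).
suff H2 l' : itv_partition b c l' ->
    (curve_length a b g <= curve_length a c g - (polygon_length g b l')%:E)%E.
  have abf : curve_length a b g \is a fin_num.
    have : exists l', itv_partition b c l'.
      move: bc; rewrite le_eqVlt => /predU1P[<-|/itv_partition1 h].
        by exists [::]; split => /=.
      by eexists; exact: h.
    move=> [l' /H2 h]; rewrite ge0_fin_numE ?curve_length_ge0//.
    apply: (le_lt_trans h); rewrite ltey_eq fin_numB acf//=.
  rewrite addeC -leeBrDr//; apply: curve_length_le => l' /H2.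
  by rewrite !leeBrDr// addeC.
by move=> bcl; apply: curve_length_le => l abl; rewrite leeBrDr// H.
Qed.

(** Splitting [F] at [b] makes it superadditive, and the triangle inequality
    through [g b] makes it dominate the distance. *)
Lemma curve_lengthD g a b c : a <= b -> b <= c ->
  (curve_length a c g = curve_length a b g + curve_length b c g)%E.
Proof.
move=> ab bc; apply/eqP; rewrite eq_le curve_length_superadditive// andbT.
pose F s t := (curve_length (Order.min s b) (Order.min t b) g +
               curve_length (Order.max s b) (Order.max t b) g)%E.
have -> : (curve_length a b g + curve_length b c g = F a c)%E.
  by rewrite /F (min_idPl ab) (min_idPr bc) (max_idPr ab) (max_idPl bc).
have monm s t : s <= t -> Order.min s b <= Order.min t b.
  by move=> st; rewrite le_min !ge_min st lexx orbT.
have monM s t : s <= t -> Order.max s b <= Order.max t b.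
  by move=> st; rewrite ge_max !le_max st lexx orbT.
apply: curve_length_le_superadditive.
- by move=> s _ _; rewrite adde_ge0// curve_length_ge0.
- move=> s t _ /ltW st _.
  apply: (@le_trans _ _ ((mdist (g (Order.min s b)) (g (Order.min t b)))%:E +
                         (mdist (g (Order.max s b)) (g (Order.max t b)))%:E)%E).
    rewrite -EFinD lee_fin.
    case: (leP t b) => [tb|/ltW bt].
      have sb := le_trans st tb.
      by rewrite (min_idPl sb) (max_idPr sb) mdistxx addr0.
    case: (leP s b) => [sb|/ltW bs]; first exact: metric_triangle.
    by rewrite mdistxx add0r.
  by apply: leeD; apply: mdist_le_curve_length; [exact: monm|exact: monM].
- move=> s t u _ /ltW st tu _; rewrite /F addeACA.
  by apply: leeD; apply: curve_length_superadditive;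
    [exact: monm|exact: monm|exact: monM|exact: monM].
Qed.

Lemma curve_lengthxx g a : curve_length a a g = 0%E.
Proof.
apply/eqP; rewrite eq_le curve_length_ge0// andbT.
by apply: curve_length_le => l /itv_partitionxx ->.
Qed.

End length.

(** * Arc length as a Stieltjes measure *)

Section clamp.
Context {R : realType}.
Implicit Types s t : R.

Definition clamp t : R := Order.max 0 (Order.min t 1).

Lemma clamp_ge0 t : 0 <= clamp t.
Proof. by rewrite le_max lexx. Qed.

Lemma clamp_le1 t : clamp t <= 1.
Proof. by rewrite ge_max ler01 ge_min lexx orbT. Qed.

Lemma clamp_id t : 0 <= t -> t <= 1 -> clamp t = t.
Proof. by move=> t0 t1; rewrite /clamp (min_idPl t1) (max_idPr t0). Qed.

Lemma clampK t : clamp (clamp t) = clamp t.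
Proof. by rewrite clamp_id ?clamp_ge0 ?clamp_le1. Qed.

Lemma clamp0 t : t <= 0 -> clamp t = 0.
Proof.
by move=> t0; rewrite /clamp (min_idPl (le_trans t0 ler01)) (max_idPl t0).
Qed.

Lemma clamp1 t : 1 <= t -> clamp t = 1.
Proof. by move=> t1; rewrite /clamp (min_idPr t1) (max_idPr ler01). Qed.

Lemma le_clamp s t : s <= t -> clamp s <= clamp t.
Proof.
by move=> st; rewrite ge_max le_max lexx/= !le_max !le_min !ge_min st lexx !orbT.
Qed.

Lemma clamp_lipschitz s t : `|clamp s - clamp t| <= `|s - t|.
Proof.
wlog st : s t / s <= t => [H|].
  by have [/H//|/ltW/H] := leP s t; rewrite distrC [leRHS]distrC.
rewrite distrC [leRHS]distrC !ger0_norm ?subr_ge0 ?le_clamp//.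
have [s0|s0] := leP s 0; have [t0|t0] := leP t 0;
have [s1|s1] := leP s 1; have [t1|t1] := leP t 1;
rewrite ?(clamp0 s0) ?(clamp0 t0) ?(clamp1 (ltW s1)) ?(clamp1 (ltW t1))
  ?(clamp_id (ltW s0) s1) ?(clamp_id (ltW t0) t1); lra.
Qed.

Lemma continuous_clamp : continuous clamp.
Proof.
move=> x; apply/cvgrPdist_lt => e e0; near=> y.
apply: le_lt_trans (clamp_lipschitz _ _) _.
near: y; move: e e0; apply/cvgrPdist_lt; exact: cvg_id.
Unshelve. all: by end_near. Qed.

End clamp.

Section stieltjes.
Context {R : realType}.
Implicit Types (s t : R) (V : cumulative R R).

Lemma lebesgue_stieltjes_itvoc V s t : s <= t ->
  lebesgue_stieltjes_measure V `]s, t]%classic = (V t - V s)%:E.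
Proof.
move=> st; rewrite /lebesgue_stieltjes_measure/= /measure_extension.
rewrite measurable_mu_extE/=; last exact: is_ocitv.
by rewrite wlength_itv_bnd.
Qed.

Lemma lebesgue_stieltjes_set1 V t : {for t, continuous V} ->
  lebesgue_stieltjes_measure V [set t] = 0%E.
Proof.
move=> cV; apply/eqP; rewrite eq_le measure_ge0 andbT.
apply/lee_addgt0Pr => e e0; rewrite add0e.
have : \forall s \near t, `|V t - V s| < e by move/cvgrPdist_lt : cV; apply.
move=> [d /= d0 /(_ (t - d / 2))] /=.
rewrite opprB addrC subrK gtr0_norm ?divr_gt0// ltr_pdivrMr// ltr_pMr// ltr1n.
move=> /(_ isT) Vd.
have td : t - d / 2 <= t by rewrite gerBl ltW// divr_gt0.
apply: (@le_trans _ _ (lebesgue_stieltjes_measure V `]t - d / 2, t]%classic)).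
  apply: le_measure; rewrite ?inE//.
  by move=> _ ->; rewrite /= in_itv/= lexx andbT ltrBlDr ltrDl divr_gt0.
by rewrite lebesgue_stieltjes_itvoc// lee_fin (le_trans _ (ltW Vd))// ler_norm.
Qed.

Lemma lebesgue_stieltjes_itvcc V s t : {for s, continuous V} -> s <= t ->
  lebesgue_stieltjes_measure V `[s, t]%classic = (V t - V s)%:E.
Proof.
move=> cV st; rewrite -(setU1itv false) ?bnd_simp//.
rewrite measureU//=.
- by rewrite lebesgue_stieltjes_set1// add0e lebesgue_stieltjes_itvoc.
- by apply/seteqP; split => // x /= [->]; rewrite in_itv/= ltxx.
Qed.

(** The Stieltjes measure of a continuous function that is constant outside
    [0, 1] has neither atoms nor mass outside [0, 1], so half-open and closed
    intervals carry the same information. *)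
Lemma lebesgue_stieltjes_unique01 V (nu : {measure set (measurableTypeR R) -> \bar R}) :
  continuous V -> (forall t, V t = V (clamp t)) ->
  (forall s t, 0 <= s -> s <= t -> t <= 1 -> nu `[s, t]%classic = (V t - V s)%:E) ->
  forall A : set (measurableTypeR R), measurable A ->
  lebesgue_stieltjes_measure V A = nu (A `&` `[(0 : R), 1]%classic).
Proof.
move=> cV Vc nuV A mA.
have m01 : measurable (`[(0 : R), 1]%classic : set (measurableTypeR R)) by [].
rewrite (@lebesgue_stieltjes_measure_unique _ V (mrestr nu m01))//= => _ [[a b] _ <-] /=.
rewrite /mrestr /=.
have [ba|ab] := leP b a.
  by rewrite set_itv_ge ?bnd_simp -?leNgt// set0I !measure0.
rewrite lebesgue_stieltjes_itvoc ?ltW// Vc [V a]Vc.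
have [b0|b0] := ltP b 0.
  rewrite !clamp0 ?(ltW b0) ?(ltW (lt_trans ab b0))// subrr.
  rewrite [X in nu X](_ : _ = set0) ?measure0//.
  by apply/seteqP; split => // x /=; rewrite !in_itv/= => -[] ? ?; lra.
have [a0|a0] := ltP a 0.
  rewrite (clamp0 (ltW a0)) -nuV ?lexx ?clamp_ge0 ?clamp_le1//; congr (nu _).
  apply/esym/seteqP; split => x /=; rewrite !in_itv/=.
    by move=> -[/andP[_ xb] /andP[x0 x1]]; rewrite x0/= -(clamp_id x0 x1) le_clamp.
  move=> /andP[x0 xb]; have x1 := le_trans xb (clamp_le1 b).
  rewrite x0 x1 (lt_le_trans a0 x0)/=; split => //.
  rewrite leNgt; apply/negP => bx.
  by move: xb; rewrite (clamp_id b0 (le_trans (ltW bx) x1)) leNgt bx.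
have [a1|a1] := ltP 1 a.
  rewrite !clamp1 ?(ltW a1) ?(ltW (lt_trans a1 ab))// subrr.
  rewrite [X in nu X](_ : _ = set0) ?measure0//.
  by apply/seteqP; split => // x /=; rewrite !in_itv/= => -[] /andP[] ? ? /andP[] ? ?; lra.
rewrite (clamp_id a0 a1).
have acb : a <= clamp b by rewrite -(clamp_id a0 a1) le_clamp// ltW.
have nua : nu [set a] = 0%E by rewrite -set_itv1 nuV// subrr.
rewrite -nuV ?clamp_le1//.
transitivity (nu ([set a] `|` `]a, clamp b]%classic)).
  by rewrite (setU1itv false) ?bnd_simp.
rewrite measureU//=; last first.
  by apply/seteqP; split => // x /= [->]; rewrite in_itv/= ltxx.
rewrite nua add0e; congr (nu _).
apply/esym/seteqP; split => x /=; rewrite !in_itv/=.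
  move=> -[/andP[ax xb] /andP[x0 x1]]; rewrite ax/=.
  by rewrite -(clamp_id x0 x1) le_clamp.
move=> /andP[ax xb]; have x1 := le_trans xb (clamp_le1 b).
have x0 := le_trans a0 (ltW ax).
rewrite ax x0 x1/=; split => //.
rewrite leNgt; apply/negP => bx.
by move: xb; rewrite (clamp_id b0 (le_trans (ltW bx) x1)) leNgt bx.
Qed.

End stieltjes.

Section tame.
Context {R : realType} {X : completeMetricType R}.
Implicit Types (s t : R) (g : R -> X).

(** The curves with a continuous finite length function: [H] is a primitive of
    the speed for an absolutely continuous curve, and a linear function for a
    Lipschitz one. *)
Definition tame g : Prop := exists2 H : R -> R, continuous H &
  forall s t, 0 <= s -> s <= t -> t <= 1 -> mdist (g s) (g t) <= H t - H s.

(** Extended by constants outside [0, 1], to be the distribution function of a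
    measure on the line. *)
Definition arc_length g t : R := fine (curve_length 0 (clamp t) g).

Lemma tame_length_le g : tame g -> exists2 H : R -> R, continuous H &
  forall s t, 0 <= s -> s <= t -> t <= 1 ->
    (curve_length s t g <= (H t - H s)%:E)%E.
Proof.
move=> [H cH gH]; exists H => // s t s0 st t1.
apply: (curve_length_le_superadditive (F := fun s t => (H t - H s)%:E)).
- by move=> u _ _; rewrite subrr.
- move=> u v su /ltW uv vt; rewrite lee_fin gH//.
    exact: le_trans su.
  exact: le_trans t1.
- by move=> u v w _ _ _ _; rewrite -EFinD lee_fin; lra.
Qed.

Lemma tame_length_fin g s t : tame g -> 0 <= s -> s <= t -> t <= 1 ->
  curve_length s t g \is a fin_num.
Proof.
move=> /tame_length_le[H _ gH] s0 st t1.
by rewrite ge0_fin_numE ?curve_length_ge0// (le_lt_trans (gH s t _ _ _))// ltry.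
Qed.

Lemma arc_lengthB g s t : tame g -> 0 <= s -> s <= t -> t <= 1 ->
  (arc_length g t - arc_length g s)%:E = curve_length s t g.
Proof.
move=> tg s0 st t1.
rewrite /arc_length !clamp_id ?(le_trans s0)// ?(le_trans st)//.
rewrite (@curve_lengthD _ _ g 0 s t)// fineD ?tame_length_fin// ?(le_trans st)//.
by rewrite addrC addKr fineK// tame_length_fin.
Qed.

Lemma arc_length_clamp g t : arc_length g t = arc_length g (clamp t).
Proof. by rewrite /arc_length clampK. Qed.

Lemma arc_length0 g : arc_length g 0 = 0.
Proof. by rewrite /arc_length clamp0// curve_lengthxx. Qed.

Lemma arc_length_nd g : tame g -> nondecreasing (arc_length g).
Proof.
move=> tg s t st; rewrite arc_length_clamp [leRHS]arc_length_clamp.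
rewrite -subr_ge0 -lee_fin arc_lengthB ?clamp_ge0 ?clamp_le1 ?le_clamp//.
by rewrite curve_length_ge0// le_clamp.
Qed.

Lemma arc_length_continuous g : tame g -> continuous (arc_length g).
Proof.
move=> tg; have [H cH gH] := tame_length_le tg.
have HB s t : `|arc_length g s - arc_length g t| <= `|H (clamp s) - H (clamp t)|.
  wlog st : s t / s <= t => [W|].
    by have [/W//|/ltW/W] := leP s t; rewrite distrC [leRHS]distrC.
  rewrite distrC [leRHS]distrC ger0_norm ?subr_ge0 ?arc_length_nd//.
  apply: le_trans (ler_norm _).
  rewrite arc_length_clamp [X in _ - X]arc_length_clamp.
  by rewrite -lee_fin arc_lengthB ?gH ?clamp_ge0 ?clamp_le1 ?le_clamp.
move=> x; apply/cvgrPdist_lt => e e0; near=> y.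
apply: le_lt_trans (HB _ _) _.
near: y.
have : H \o clamp @ x --> H (clamp x).
  by apply: continuous_comp; [exact: continuous_clamp|exact: cH].
by move/cvgrPdist_lt; apply.
Unshelve. all: by end_near. Qed.

Section arc_lebesgue_stieltjes.
Variables (g : R -> X) (tg : tame g).

Let rc : right_continuous (arc_length g).
Proof. exact/right_continuousW/arc_length_continuous. Qed.

HB.instance Definition _ := isCumulative.Build R _ R (arc_length g)
  (arc_length_nd tg) rc.

Definition arc_stieltjes : {measure set (measurableTypeR R) -> \bar R} :=
  lebesgue_stieltjes_measure (arc_length g).

Lemma arc_stieltjesP : is_arc_measure 0 1 g arc_stieltjes.
Proof.
move=> s t s0 st t1; rewrite -arc_lengthB//.
by apply: lebesgue_stieltjes_itvcc => //; exact: arc_length_continuous.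
Qed.

Lemma arc_stieltjes_unique (nu : {measure set (measurableTypeR R) -> \bar R}) :
  is_arc_measure 0 1 g nu -> forall A : set (measurableTypeR R),
  measurable A -> A `<=` `[(0 : R), 1]%classic -> nu A = arc_stieltjes A.
Proof.
move=> nuP A mA A01; rewrite -[in LHS](setIidl A01).
apply/esym/lebesgue_stieltjes_unique01 => //.
- exact: arc_length_continuous.
- exact: arc_length_clamp.
- by move=> s t s0 st t1; rewrite nuP// arc_lengthB.
Qed.

End arc_lebesgue_stieltjes.

Lemma arc_measureP g : tame g -> is_arc_measure 0 1 g (arc_measure 0 1 g).
Proof.
move=> tg; rewrite /arc_measure; case: pselect => [h|[]]; last first.
  by exists (arc_stieltjes tg); exact: arc_stieltjesP.
exact: projT2 (cid h).
Qed.

(** [arc_measure] is chosen arbitrarily; by uniqueness on [0, 1] any measure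
    that gives the right mass to intervals computes the line integrals. *)
Lemma line_integralE g (nu : {measure set (measurableTypeR R) -> \bar R})
  (rho : X -> \bar R) : tame g -> is_arc_measure 0 1 g nu ->
  line_integral 0 1 g rho = (\int[nu]_(t in `[0%R, 1%R]) rho (g t))%E.
Proof.
move=> tg nuP; rewrite /line_integral.
have /fin_numPlt/andP[_] := @tame_length_fin g 0 1 tg (lexx _) ler01 (lexx _).
rewrite lt_neqAle => /andP[/negPf -> _].
apply: eq_measure_integral => A mA A01.
rewrite (arc_stieltjes_unique tg (arc_measureP tg) mA A01).
by rewrite (arc_stieltjes_unique tg nuP mA A01).
Qed.

Lemma tame_continuous g : tame g -> continuous (g \o clamp).
Proof.
move=> [H cH gH] x; apply/cvg_ballP => e e0; near=> y.
rewrite ballEmdist/=.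
have HB s t : mdist (g (clamp s)) (g (clamp t)) <= `|H (clamp s) - H (clamp t)|.
  wlog st : s t / s <= t => [W|].
    by have [/W//|/ltW/W] := leP s t; rewrite metric_sym distrC.
  rewrite distrC; apply: le_trans (ler_norm _).
  by rewrite gH ?clamp_ge0 ?clamp_le1 ?le_clamp.
apply: le_lt_trans (HB _ _) _.
near: y.
have : H \o clamp @ x --> H (clamp x).
  by apply: continuous_comp; [exact: continuous_clamp|exact: cH].
by move/cvgrPdist_lt; apply.
Unshelve. all: by end_near. Qed.

End tame.

(** * Powers of suprema and of counting functions *)

Section ereal_powers.
Context {R : realType}.
Local Open Scope ereal_scope.
Implicit Types (x y : \bar R) (p : R).

Lemma le_poweR p x y : (0 <= p)%R -> 0 <= x -> x <= y -> x `^ p <= y `^ p.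
Proof.
move=> p0 x0 xy; apply: gt0_ler_poweR => //; rewrite in_itv/= leey andbT//.
exact: le_trans xy.
Qed.

Lemma poweR_le_cancel p x y : (0 < p)%R -> 0 <= x -> x `^ p <= y ->
  x <= y `^ p^-1.
Proof.
move=> p0 x0 xy; rewrite -[leLHS]poweRe1// -(@mulfV _ p) ?gt_eqF// poweRrM.
by apply: le_poweR; rewrite ?poweR_ge0// invr_ge0 ltW.
Qed.

Lemma nneseries_ge_term (u : nat -> \bar R) n :
  (forall k, 0 <= u k) -> u n <= \sum_(k <oo) u k.
Proof.
move=> u0; apply: le_trans (@nneseries_lim_ge _ u xpredT 0%N n.+1 _) => //.
by rewrite big_nat_recr//= leeDr// sume_ge0.
Qed.

Lemma esups_ge_term (u : nat -> \bar R) n : u n <= esups u 0%N.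
Proof. by apply: ereal_sup_ubound; exists n. Qed.

(** A supremum rather than a sum of a sequence of functions is formed below, as
    its L^p norm is then controlled without Minkowski's inequality. *)
Lemma esups_poweR_le p (u : nat -> \bar R) : (0 < p)%R -> (forall k, 0 <= u k) ->
  esups u 0%N `^ p <= \sum_(k <oo) u k `^ p.
Proof.
move=> p0 u0; have S0 k : 0 <= u k `^ p by exact: poweR_ge0.
have : esups u 0%N <= (\sum_(k <oo) u k `^ p) `^ p^-1.
  apply: ge_ereal_sup => _ [n _ <-]; apply: poweR_le_cancel => //.
  exact: (nneseries_ge_term (u := fun k => u k `^ p)).
move=> /(le_poweR (ltW p0)) /= -/(_ (le_trans (u0 0%N) (esups_ge_term u 0%N))).
by rewrite -poweRrM mulVf ?gt_eqF// poweRe1// nneseries_ge0.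
Qed.

(** When [x] lies in [D n], the [n.+1]-th partial sum is at most [n.+1]; when it
    does not, this partial sum is the preceding one. *)
Lemma indic_sum_poweR_le (T : Type) p (D : nat -> set T) (x : T) : (0 < p)%R ->
  (\sum_(k <oo) (\1_(D k) x)%:E) `^ p <=
  \sum_(k <oo) (k.+1%:R `^ p)%:E * (\1_(D k) x)%:E.
Proof.
move=> p0; set T0 := \sum_(k <oo) _ * _.
have I0 k : (0 <= (\1_(D k) x)%:E :> \bar R) by rewrite lee_fin.
have S0 k : 0 <= (k.+1%:R `^ p)%:E * (\1_(D k) x)%:E.
  by rewrite mule_ge0// lee_fin powR_ge0.
have T00 : 0 <= T0 by apply: nneseries_ge0.
have H n : (\sum_(0 <= k < n) (\1_(D k) x)%:E) `^ p <=
    \sum_(0 <= k < n) (k.+1%:R `^ p)%:E * (\1_(D k) x)%:E.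
  elim: n => [|n ih]; first by rewrite !big_geq// poweR0r ?gt_eqF.
  rewrite big_nat_recr//= [leRHS]big_nat_recr//=.
  have [xD|xD] := pselect (D n x); last first.
    by rewrite indicE memNset// !mule0 !adde0.
  rewrite [in leRHS]indicE mem_set// mule1.
  apply: le_trans (leeDr _ _); last by apply: sume_ge0.
  rewrite -poweR_EFin; apply: le_poweR; first exact: ltW.
    by rewrite adde_ge0// sume_ge0.
  rewrite -addn1 natrD EFinD; apply: leeD; last by rewrite lee_fin indicE; case: (_ \in _).
  rewrite sumEFin lee_fin; apply: le_trans (_ : \sum_(0 <= k < n) 1 <= _)%R.
    by apply: ler_sum => k _; rewrite indicE; case: (_ \in _).
  by rewrite big_const_nat subn0 iter_addr addr0.
suff : \sum_(k <oo) (\1_(D k) x)%:E <= T0 `^ p^-1.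
  move=> /(le_poweR (ltW p0)); rewrite -poweRrM mulVf ?gt_eqF// poweRe1//; apply.
  exact: nneseries_ge0.
apply: lime_le; first by apply: is_cvg_nneseries.
apply: nearW => n; apply: poweR_le_cancel => //.
  exact: sume_ge0.
by apply: le_trans (H n) _; apply: nneseries_lim_ge.
Qed.

End ereal_powers.

(** * Line integrals and null families for the modulus *)

Section line_integral.
Context {R : realType} {X : completeMetricType R}.
Local Open Scope ereal_scope.
Implicit Types (g : R -> X) (rho : borel X -> \bar R).

Local Notation I01 := (`[0%R, 1%R]%classic : set (measurableTypeR R)).

Lemma measurable_tame_clamp g : tame g ->
  measurable_fun setT (g \o clamp : measurableTypeR R -> borel X).
Proof.
move=> tg.
apply: (@measurability _ _ (measurableTypeR R) (borel X) _ _ (@open X)) => //.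
move=> _ [U oU <-]; rewrite setTI.
apply: open_measurable.
by apply: open_comp => // x _; exact: tame_continuous.
Qed.

Lemma measurable_tame g : tame g ->
  measurable_fun I01 (g : measurableTypeR R -> borel X).
Proof.
move=> tg; apply: (@eq_measurable_fun _ _ (measurableTypeR R) (borel X) I01
  (g \o clamp : measurableTypeR R -> borel X)).
  by move=> t; rewrite inE /= in_itv/= => /andP[t0 t1]; rewrite clamp_id.
exact: (measurable_funTS (measurable_tame_clamp tg)).
Qed.

Lemma measurable_comp_tame g rho : tame g -> measurable_fun setT rho ->
  measurable_fun I01 (rho \o g : measurableTypeR R -> \bar R).
Proof.
move=> tg mrho.
exact: (measurableT_comp mrho (measurable_tame tg)).
Qed.

Definition length_in g (A : set X) : \bar R := arc_measure 0 1 g (I01 `&` g @^-1` A).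

Let lineE g rho : tame g ->
  line_integral 0 1 g rho = \int[arc_measure 0 1 g]_(t in I01) rho (g t).
Proof. by move=> tg; rewrite (line_integralE _ tg (arc_measureP tg)). Qed.

Lemma line_integral_ge0 g rho : tame g -> (forall x, 0 <= rho x) ->
  0 <= line_integral 0 1 g rho.
Proof. by move=> tg rho0; rewrite lineE//; apply: integral_ge0. Qed.

Lemma le_line_integral g rho rho' : tame g ->
  measurable_fun setT rho -> measurable_fun setT rho' ->
  (forall x, 0 <= rho x) ->
  (forall t, (0 <= t)%R -> (t <= 1)%R -> rho (g t) <= rho' (g t)) ->
  line_integral 0 1 g rho <= line_integral 0 1 g rho'.
Proof.
move=> tg mrho mrho' rho0 rr'; rewrite !lineE//.
apply: ge0_le_integral => //.
- exact: measurable_comp_tame.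
- exact: measurable_comp_tame.
- by move=> t /=; rewrite in_itv/= => /andP[t0 t1]; exact: rr'.
Qed.

Lemma line_integralD g rho rho' : tame g ->
  measurable_fun setT rho -> measurable_fun setT rho' ->
  (forall x, 0 <= rho x) -> (forall x, 0 <= rho' x) ->
  line_integral 0 1 g (fun x => rho x + rho' x) =
  line_integral 0 1 g rho + line_integral 0 1 g rho'.
Proof.
move=> tg mrho mrho' rho0 rho'0; rewrite !lineE// ge0_integralD//.
- exact: measurable_comp_tame.
- exact: measurable_comp_tame.
Qed.

Lemma line_integralZ g rho (c : R) : tame g -> measurable_fun setT rho ->
  (forall x, 0 <= rho x) -> (0 <= c)%R ->
  line_integral 0 1 g (fun x => c%:E * rho x) = c%:E * line_integral 0 1 g rho.
Proof.
move=> tg mrho rho0 c0; rewrite !lineE// ge0_integralZl//.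
exact: measurable_comp_tame.
Qed.

Lemma line_integral_cst1 g : tame g ->
  line_integral 0 1 g (cst 1) = curve_length 0 1 g.
Proof.
by move=> tg; rewrite lineE// integral_cst//= mul1e (arc_measureP tg).
Qed.

Lemma measurable_tame_preimage g (A : set (borel X)) : tame g -> measurable A ->
  measurable (I01 `&` g @^-1` A).
Proof. by move=> tg mA; apply: (measurable_tame tg). Qed.

(** Monotone convergence. *)
Lemma line_integral_indic_sum g (U : nat -> set (borel X)) : tame g ->
  (forall k, measurable (U k)) ->
  line_integral 0 1 g (fun x => \sum_(k <oo) (\1_(U k) x)%:E) =
  \sum_(k <oo) length_in g (U k).
Proof.
move=> tg mU; rewrite lineE// integral_nneseries//.
- apply: eq_eseriesr => k _; rewrite /length_in setIC.
  transitivity (\int[arc_measure 0 1 g]_(t in I01) (\1_(I01 `&` g @^-1` U k) t)%:E).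
    apply: eq_integral => t; rewrite inE => tI; congr (_%:E).
    rewrite !indicE; congr (nat_of_bool _)%:R.
    by apply/idP/idP; rewrite !inE/= => //= -[].
  rewrite integral_indic//; last exact: measurable_tame_preimage.
  by congr (arc_measure _ _ _ _); rewrite setIC setIA setIid setIC.
- move=> k; apply: (measurable_comp_tame tg (rho := EFin \o \1_(U k))).
  exact/measurable_EFinP/measurable_indic.
Qed.

Lemma length_in_fin g (A : set (borel X)) : tame g -> measurable A ->
  length_in g A \is a fin_num.
Proof.
move=> tg mA; rewrite ge0_fin_numE ?measure_ge0//.
apply: (@le_lt_trans _ _ (arc_measure 0 1 g I01)).
  by apply: le_measure; rewrite ?inE//; exact: measurable_tame_preimage.
by rewrite (arc_measureP tg)// -ge0_fin_numE ?curve_length_ge0// tame_length_fin.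
Qed.

End line_integral.

Section modulus.
Context {R : realType} {X : completeMetricType R}.
Variables (mu : {measure set (borel X) -> \bar R}) (p : R).
Hypothesis p1 : 1 <= p.
Local Open Scope ereal_scope.
Implicit Types (G : set (R -> X)) (rho : borel X -> \bar R).

Let p0 : (0 < p)%R. Proof. exact: lt_le_trans p1. Qed.

Lemma tame_C01 (g : R -> X) : tame g -> C01 g.
Proof.
move=> tg; rewrite /C01/=.
apply: (@subspace_eq_continuous _ _ _ (g \o clamp)).
  by move=> t; rewrite inE /= in_itv/= => /andP[t0 t1]; rewrite /= clamp_id.
exact/continuous_subspaceT/tame_continuous.
Qed.

Lemma admissible01P G rho : G `<=` tame ->
  admissible (curves01 G) rho <->
  [/\ measurable_fun setT rho, forall x, 0 <= rho x &
      forall g, G g -> 1 <= rho (g 0%R) + rho (g 1%R) + line_integral 0 1 g rho].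
Proof.
move=> Gt; split=> -[mrho rho0 H]; split=> //.
- by move=> g Gg; exact: (H (Curve ler01 (tame_C01 (Gt _ Gg)))).
- by move=> [lo hi g lh cg] [/= -> -> Gg]; exact: H.
Qed.

Lemma Mod1_ge0 G : 0 <= Mod1 mu p (curves01 G).
Proof.
by apply: le_ereal_inf_tmp => _ [rho _ <-]; apply: integral_ge0 => x _; exact: poweR_ge0.
Qed.

Lemma Mod1_le G rho : admissible (curves01 G) rho ->
  Mod1 mu p (curves01 G) <= \int[mu]_x (rho x `^ p).
Proof. by move=> h; apply: ereal_inf_lbound; exists rho. Qed.

Lemma measurable_fun_poweR rho : measurable_fun setT rho ->
  measurable_fun setT (fun x => rho x `^ p).
Proof.
by move=> mrho; exact: (measurableT_comp (measurable_poweR p) mrho).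
Qed.

(** Arbitrarily small positive multiples of [rho] are still admissible. *)
Lemma Mod1_eq0_infinite G rho : G `<=` tame -> measurable_fun setT rho ->
  (forall x, 0 <= rho x) -> \int[mu]_x (rho x `^ p) < +oo ->
  (forall g, G g -> rho (g 0%R) + rho (g 1%R) + line_integral 0 1 g rho = +oo) ->
  Mod1 mu p (curves01 G) = 0.
Proof.
move=> Gt mrho rho0 rhop H; apply/eqP; rewrite eq_le Mod1_ge0 andbT.
set I := \int[mu]_x _ in rhop.
have I0 : 0 <= I by apply: integral_ge0 => x _; exact: poweR_ge0.
have If : I \is a fin_num by rewrite ge0_fin_numE.
have key (e : R) : (0 < e)%R -> Mod1 mu p (curves01 G) <= (e `^ p)%:E * I.
  move=> e0; have -> : (e `^ p)%:E * I = \int[mu]_x ((e%:E * rho x) `^ p).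
    rewrite -ge0_integralZl//.
    - apply: eq_integral => x _; rewrite poweRM// ?poweR_EFin//.
      by rewrite lee_fin ltW.
    - exact: measurable_fun_poweR.
    - by move=> x _; exact: poweR_ge0.
    - by rewrite lee_fin powR_ge0.
  apply: Mod1_le; apply/admissible01P => //; split.
  - exact: (@emeasurable_funM _ _ _ setT (cst e%:E)).
  - by move=> x; rewrite mule_ge0// lee_fin ltW.
  - move=> g Gg; rewrite line_integralZ//; [|exact: Gt|exact: ltW].
    rewrite -!ge0_muleDr ?adde_ge0// ?H//.
      by rewrite gt0_muley ?leey// lte_fin.
    by apply: line_integral_ge0 => //; exact: Gt.
apply/lee_addgt0Pr => e e0; rewrite add0e.
(* So that [c * I <= e], also when [I = 0]. *)
pose c := (e / (fine I + 1))%R.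
have I10 : (0 < fine I + 1)%R by rewrite ltr_wpDl// fine_ge0.
have c0 : (0 < c)%R by rewrite divr_gt0.
have := key (c `^ p^-1)%R; rewrite powR_gt0// -powRrM mulVf ?gt_eqF// (powRr1 (ltW c0)).
move=> /(_ isT) keyc; apply: (le_trans keyc).
rewrite -(fineK If) -EFinM lee_fin /c mulrAC ler_pdivrMr// ler_pM2l//.
by rewrite lerDl.
Qed.

(** The supremum of admissible functions with summable energies is admissible
    for the union. *)
Lemma Mod1_eq0_bigcup G (Gn : nat -> set (R -> X)) : G `<=` tame ->
  (forall n, Gn n `<=` tame) -> G `<=` \bigcup_n Gn n ->
  (forall n, Mod1 mu p (curves01 (Gn n)) = 0) ->
  Mod1 mu p (curves01 G) = 0.
Proof.
move=> Gt Gnt GGn Gn0; apply/eqP; rewrite eq_le Mod1_ge0 andbT.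
apply/lee_addgt0Pr => e e0; rewrite add0e.
have ex n : exists rho, admissible (curves01 (Gn n)) rho /\
    \int[mu]_x (rho x `^ p) <= (e / (2 ^ n.+1)%:R)%:E.
  have : Mod1 mu p (curves01 (Gn n)) < (e / (2 ^ n.+1)%:R)%:E.
    by rewrite Gn0 lte_fin divr_gt0// ltr0n expn_gt0.
  by move=> /ereal_inf_lt[_ [rho arho <-] /ltW h]; exists rho.
have [rho /all_and2[arho irho]] := choice ex.
have {}arho n := (admissible01P (rho n) (Gnt n)).1 (arho n).
have mrho n : measurable_fun setT (rho n) by case: (arho n).
have rho0 n x : 0 <= rho n x by case: (arho n).
have srho0 x : 0 <= esups (rho ^~ x) 0%N.
  exact: le_trans (rho0 0%N x) (esups_ge_term (rho^~ x) 0%N).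
have ms : measurable_fun setT (fun x => esups (rho ^~ x) 0%N).
  exact: measurable_fun_esups.
apply: le_trans (_ : \int[mu]_x (esups (rho ^~ x) 0%N `^ p) <= _).
  apply: Mod1_le; apply/admissible01P => //; split => // g Gg.
  have [n _ Gng] := GGn _ Gg; have [_ _ /(_ _ Gng) h] := arho n.
  apply: le_trans h _; apply: leeD; first by apply: leeD; exact: (esups_ge_term (rho^~ _)).
  apply: le_line_integral => //; first exact: Gt.
  by move=> t _ _; exact: (esups_ge_term (rho^~ _)).
apply: (@le_trans _ _ (\int[mu]_x (\sum_(n <oo) rho n x `^ p))).
  apply: ge0_le_integral => //.
  - by move=> x _; exact: poweR_ge0.
  - exact: measurable_fun_poweR.
  - apply: ge0_emeasurable_sum => [n x _ _|n _]; first exact: poweR_ge0.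
    exact: measurable_fun_poweR.
  - by move=> x _; exact: esups_poweR_le.
rewrite integral_nneseries//; last 2 first.
  by move=> n; exact: measurable_fun_poweR.
  by move=> n x _; exact: poweR_ge0.
apply: le_trans (epsilon_trick0 xpredT (ltW e0)).
by apply: lee_nneseries => // n _ _; apply: integral_ge0 => x _; exact: poweR_ge0.
Qed.

End modulus.

(** * Absolutely continuous and Lipschitz curves *)

Section restricted_integral.
Context d (T : measurableType d) (R : realType).
Variables (mu : {measure set T -> \bar R}) (D : set T) (mD : measurable D).
Local Open Scope ereal_scope.

Lemma ge0_integral_mrestr (f : T -> \bar R) : measurable_fun setT f ->
  (forall x, 0 <= f x) ->
  \int[mrestr mu mD]_x f x = \int[mu]_(x in D) f x.
Proof.
move=> mf f0; rewrite (@ge0_negligible_integral _ _ _ _ setT (~` D))//.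
- rewrite setDE setCK setTI; apply: eq_measure_integral => A mA AD.
  by rewrite /= /mrestr setIidl.
- exact: measurableC.
- by rewrite /= /mrestr setICl measure0.
Qed.

End restricted_integral.

Section absolutely_continuous.
Context {R : realType} {X : completeMetricType R}.
Implicit Types (g : R -> X) (L : R).

Lemma within01_continuous_clamp (H : R -> R) :
  {within `[(0 : R), 1], continuous H} -> continuous (H \o clamp).
Proof.
move=> cH x.
have Ix : `[(0 : R), 1]%classic (clamp x).
  by rewrite /= in_itv/= clamp_ge0 clamp_le1.
have := cH (clamp x); rewrite /continuous_at.
have -> : nbhs (clamp x : subspace `[(0 : R), 1]) =
    within `[(0 : R), 1]%classic (nbhs (clamp x)).
  by rewrite nbhs_subspace_in.
move=> h; apply: cvg_trans h => P /=.
move=> hP.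
have h2 : \forall y \near x, `[(0 : R), 1]%classic (clamp y) -> P (H (clamp y)).
  exact: (@continuous_clamp R x _ hP).
suff : \forall y \near x, P (H (clamp y)) by [].
apply: filterS h2 => y; apply.
by rewrite /= in_itv/= clamp_ge0 clamp_le1.
Qed.

(** On an interval of finite length, L^r is contained in L^1, and the primitive
    of an integrable function is continuous. *)
Lemma AC01_tame (r : \bar R) g : (1 <= r)%E -> AC01 r g -> tame g.
Proof.
move=> r1 [_ [h [h0 hr gh]]].
have [mh ih] : measurable_fun setT h /\
   (@lebesgue_measure R).-integrable `[(0 : R), 1] (EFin \o h).
  have m01 : measurable (`](0 : R), 1[%classic : set (measurableTypeR R)) by [].
  have /Lfun1_integrable/integrableP[mh ih] :
    h \in Lfun (mrestr (@lebesgue_measure R) (measurable_itv `](0 : R), 1[)) 1.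
    apply: (Lfun_subset (lexx _) r1 _ r1 hr).
    by rewrite /= /mrestr setTI lebesgue_measure_itv/= lte_fin ltr01 -EFinB.
  have {}mh : measurable_fun setT h by exact/measurable_EFinP.
  split => //; apply/integrableP; split.
    exact/measurable_EFinP/measurable_funTS.
  rewrite ge0_integral_mrestr// in ih; last first.
    exact/measurableT_comp/measurable_EFinP.
  rewrite -(@integral_itv_bndoo _ _ _ _ true false) in ih => //.
  apply: measurable_funTS.
  exact/measurableT_comp/measurable_EFinP.
pose H t := (\int[@lebesgue_measure R]_(x in `[0%R, t]) h x)%R.
have ihs s t : 0 <= s -> t <= 1 ->
    (@lebesgue_measure R).-integrable `[s, t] (EFin \o h).
  move=> s0 t1; apply: (integrableS _ _ _ ih) => //.
  by apply: subset_itv; rewrite bnd_simp.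
exists (H \o clamp).
  apply: within01_continuous_clamp.
  exact: parameterized_integral_continuous.
move=> s t s0 st t1; have t0 := le_trans s0 st; have s1 := le_trans st t1.
rewrite /= (clamp_id s0 s1) (clamp_id t0 t1).
move: (st); rewrite le_eqVlt => /predU1P[<-|slt]; first by rewrite mdistxx subrr.
rewrite /H.
have <- : (\int[lebesgue_measure]_(x in `[s, t]) h x)%R =
   \int[lebesgue_measure]_(x in `[0, t]) h x -
   \int[lebesgue_measure]_(x in `[0, s]) h x.
  rewrite (@Rintegral_itvB _ h (BLeft 0%R) (BRight t) s) ?bnd_simp//; last exact: ihs.
  rewrite Rintegral_itv_obnd_cbnd//.
  apply: (integrableS _ _ _ (ihs s t s0 t1)) => //.
  by apply: subset_itv; rewrite bnd_simp.
rewrite -lee_fin; apply: (le_trans (gh s t s0 slt t1)).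
rewrite /Rintegral fineK//.
by apply: integrable_fin_num => //; exact: ihs.
Qed.

Lemma lipschitz_tame g L : (forall s t, 0 <= s -> s <= t -> t <= 1 ->
   mdist (g s) (g t) <= L * (t - s)) -> tame g.
Proof.
move=> gL; exists (fun t => L * t); first exact: mulrl_continuous.
by move=> s t s0 st t1; rewrite -mulrBr gL.
Qed.

Lemma lipschitz_AC01 (r : \bar R) g L : (1 <= r)%E -> 0 <= L ->
  (forall s t, 0 <= s -> s <= t -> t <= 1 -> mdist (g s) (g t) <= L * (t - s)) ->
  AC01 r g.
Proof.
move=> r1 L0 gL; split; first exact/tame_C01/(lipschitz_tame gL).
exists (cst L); split => //.
- apply/andP; split; rewrite inE//= /finite_norm unlock.
  case: r r1 => [r||//] r1.
    apply: poweR_lty.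
    rewrite (_ : (fun _ => _) = cst (`|L| `^ r)%:E)//.
    rewrite integral_cst//= /mrestr setTI lebesgue_measure_itv/= lte_fin ltr01.
    by rewrite -EFinB -EFinM ltry.
  case: ifPn => // m0; rewrite (_ : _ \o _ = EFin \o cst `|L|)//.
  by rewrite ess_sup_inf.ess_sup_cstr// ltry.
- move=> s t s0 st t1; rewrite (_ : (fun _ => _) = cst L%:E)// integral_cst//= lebesgue_measure_itv/= lte_fin st.
  by rewrite -EFinB -EFinM lee_fin gL// ltW.
Qed.

End absolutely_continuous.

(** * Constant speed parametrization *)

Section reparametrization.
Context {R : realType} {X : completeMetricType R}.
Implicit Types (g : R -> X).

(** The preimage is compact and, by monotonicity, contains everything between
    its minimum and its maximum. *)
Lemma preimage_itv_monotone (V : R -> R) (c d : R) : continuous V ->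
  nondecreasing V -> V 0 <= c -> c <= d -> d <= V 1 ->
  exists a b, [/\ 0 <= a, a <= b, b <= 1, V a = c /\ V b = d &
    (`[(0 : R), 1]%classic `&` V @^-1` `[c, d]%classic = `[a, b]%classic)].
Proof.
move=> cV ndV V0c cd dV1.
have sol e : c <= e -> e <= d -> exists2 u, 0 <= u <= 1 & V u = e.
  move=> ce ed.
  have [|u] := @IVT R V 0 1 e ler01 (continuous_subspaceT cV).
    rewrite (min_idPl _) ?ndV ?ler01// (max_idPr _) ?ndV ?ler01//.
    by rewrite (le_trans V0c ce) (le_trans ed dV1).
  by rewrite in_itv/=; exists u.
set P := `[(0 : R), 1]%classic `&` V @^-1` `[c, d]%classic.
have cP : compact P.
  apply: (subclosed_compact _ (@segment_compact _ 0 1)); last by move=> u [].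
  apply: closedI; first exact: interval_closed.
  by apply: closed_comp; [move=> x _; exact: cV|exact: interval_closed].
have P0 : P !=set0.
  have [u u01 Vu] := sol c (lexx _) cd.
  by exists u; split; rewrite /= in_itv/= // Vu lexx.
have cid : {within P, continuous (@idfun R)}.
  by apply: continuous_subspaceT => x; exact: cvg_id.
have [a /set_mem Pa amin] := compact_EVT_min P0 cP cid.
have [b /set_mem Pb bmax] := compact_EVT_max P0 cP cid.
have {}amin t : P t -> a <= t by move=> Pt; apply: amin; rewrite inE.
have {}bmax t : P t -> t <= b by move=> Pt; apply: bmax; rewrite inE.
have [] := Pa; rewrite /= !in_itv/= => /andP[a0 a1] /andP[ca ad].
have [] := Pb; rewrite /= !in_itv/= => /andP[b0 b1] /andP[cb bd].
exists a, b; split => //; first exact: amin.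
  split.
- apply/eqP; rewrite eq_le ca andbT.
  have [u u01 Vu] := sol c (lexx _) cd.
  rewrite -Vu; apply: ndV; apply: amin.
  by split; rewrite /= in_itv/= // Vu lexx.
- apply/eqP; rewrite eq_le bd/=.
  have [u u01 Vu] := sol d cd (lexx _).
  rewrite -Vu; apply: ndV; apply: bmax.
  by split; rewrite /= in_itv/= // Vu lexx andbT.
- apply/seteqP; split => u.
    by move=> Pu; rewrite /= in_itv/= amin// bmax.
  rewrite /= in_itv/= => /andP[au ub]; split; rewrite /= in_itv/=.
    by rewrite (le_trans a0 au) (le_trans ub b1).
  by rewrite (le_trans ca (ndV _ _ au)) (le_trans (ndV _ _ ub) bd).
Qed.

Lemma mdist_le_arc_length g s t : tame g -> 0 <= s <= 1 -> 0 <= t <= 1 ->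
  mdist (g s) (g t) <= `|arc_length g s - arc_length g t|.
Proof.
move=> tg; wlog st : s t / s <= t => [W|].
  by move=> s01 t01; have [/W|/ltW/W] := leP s t; [exact|];
    rewrite metric_sym distrC; exact.
move=> /andP[s0 s1] /andP[t0 t1]; rewrite distrC.
apply: le_trans (ler_norm _); rewrite -lee_fin arc_lengthB//.
exact: mdist_le_curve_length.
Qed.

(** With [V] the arc length of [g] and [L] its total length, [g'] is the curve
    such that [g = g' \o phi] on [0, 1] for [phi := V / L]. The image of the arc
    measure of [g] under [phi] gives mass [L * (t - s)] to [`[s, t]]; this is also
    the length of [g'] on [`[s, t]], so the image is the arc measure of [g']. *)
Lemma constant_speed g : tame g -> 0 < arc_length g 1 ->
  exists g', [/\ forall t, g' t = g' (clamp t),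
    forall s t, 0 <= s -> s <= t -> t <= 1 ->
      mdist (g' s) (g' t) <= arc_length g 1 * (t - s),
    g' 0 = g 0, g' 1 = g 1 &
    forall rho : borel X -> \bar R, measurable_fun setT rho ->
      (forall x, (0 <= rho x)%E) ->
      line_integral 0 1 g' rho = line_integral 0 1 g rho].
Proof.
move=> tg; set V := arc_length g; set L := V 1 => L0.
have cV : continuous V := arc_length_continuous tg.
have ndV : nondecreasing V := arc_length_nd tg.
have V0 : V 0 = 0 by exact: arc_length0.
have VL t : V t <= L by rewrite /V arc_length_clamp; apply: ndV; exact: clamp_le1.
have Vge0 t : 0 <= V t.
  by rewrite /V arc_length_clamp -V0; apply: ndV; exact: clamp_ge0.
have ex s : exists t, 0 <= t <= 1 /\ V t = L * clamp s.
  have [|u] := @IVT R V 0 1 (L * clamp s) ler01 (continuous_subspaceT cV).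
    rewrite (min_idPl _) ?ndV ?ler01// (max_idPr _) ?ndV ?ler01// V0.
    by rewrite mulr_ge0 ?clamp_ge0 ?(ltW L0)//= ler_piMr ?clamp_le1 ?(ltW L0).
  by rewrite in_itv/=; exists u.
have [tau /all_and2[tau01 Vtau]] := choice ex.
pose g' s := g (tau (clamp s)).
have Vtc s : V (tau (clamp s)) = L * clamp s by rewrite Vtau clampK.
have g'E t : 0 <= t <= 1 -> g t = g' (V t / L).
  move=> t01; apply: mdist_positivity; apply/eqP; rewrite eq_le mdist_ge0 andbT.
  apply: le_trans (mdist_le_arc_length tg t01 (tau01 _)) _.
  rewrite -/V Vtc clamp_id ?divr_ge0 ?Vge0 ?(ltW L0)//; last first.
    by rewrite ler_pdivrMr// mul1r.
  by rewrite mulrC divfK ?gt_eqF// subrr normr0.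
have g'c t : g' t = g' (clamp t) by rewrite /g' clampK.
have g'L s t : 0 <= s -> s <= t -> t <= 1 -> mdist (g' s) (g' t) <= L * (t - s).
  move=> s0 st t1; apply: le_trans (mdist_le_arc_length tg (tau01 _) (tau01 _)) _.
  rewrite -/V !Vtc !clamp_id ?(le_trans s0 st) ?(le_trans st t1)//.
  by rewrite -mulrBr normrM gtr0_norm// distrC ger0_norm ?subr_ge0.
have tg' : tame g' := lipschitz_tame g'L.
exists g'; split => //.
- by rewrite g'E ?lexx ?ler01// V0 mul0r.
- by rewrite [in RHS]g'E ?lexx ?ler01// divff// gt_eqF.
move=> rho mrho rho0.
have Lg' : curve_length 0 1 g' = L%:E.
  apply/eqP; rewrite eq_le; apply/andP; split.
    have -> : L%:E = (L * 1 - L * 0)%:E by rewrite mulr1 mulr0 subr0.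
    apply: (curve_length_le_superadditive (F := fun s t => (L * t - L * s)%:E)).
    - by move=> s _ _; rewrite subrr.
    - by move=> s t s0 /ltW st t1; rewrite lee_fin -mulrBr g'L.
    - by move=> s t u _ _ _ _; rewrite -EFinD lee_fin; lra.
  have -> : L%:E = curve_length 0 1 g by rewrite -arc_lengthB// arc_length0 subr0.
  have /= := @curve_length_le_superadditive _ _ g 0 1
    (fun s t => curve_length (V s / L) (V t / L) g').
  rewrite V0 mul0r divff ?gt_eqF//; apply.
  - by move=> s _ _; rewrite curve_lengthxx.
  - move=> s t s0 st t1.
    rewrite !g'E ?s0 ?t1 ?(le_trans s0 (ltW st)) ?(le_trans (ltW st) t1)//.
    by apply: mdist_le_curve_length; rewrite ler_pM2r ?invr_gt0// ndV ?ltW.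
  - move=> s t u _ /ltW st tu _; apply: curve_length_superadditive;
      by rewrite ler_pM2r ?invr_gt0// ndV.
have lenle s t : 0 <= s -> s <= t -> t <= 1 ->
    (curve_length s t g' <= (L * (t - s))%:E)%E.
  move=> s0 st t1; rewrite mulrBr.
  apply: (curve_length_le_superadditive (F := fun s t => (L * t - L * s)%:E)).
  - by move=> u _ _; rewrite subrr.
  - by move=> u v su /ltW uv vt; rewrite lee_fin -mulrBr g'L// (le_trans s0, le_trans vt).
  - by move=> u v w _ _ _ _; rewrite -EFinD lee_fin; lra.
have lenE s t : 0 <= s -> s <= t -> t <= 1 ->
    curve_length s t g' = (L * (t - s))%:E.
  move=> s0 st t1; apply/eqP; rewrite eq_le lenle//=.
  have f0s := tame_length_fin tg' (lexx 0) s0 (le_trans st t1).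
  have fst := tame_length_fin tg' s0 st t1.
  have ft1 := tame_length_fin tg' (le_trans s0 st) t1 (lexx 1).
  have := lenle 0 s (lexx 0) s0 (le_trans st t1).
  have := lenle t 1 (le_trans s0 st) t1 (lexx 1).
  move: Lg'; rewrite (curve_lengthD g' s0 (le_trans st t1)) (curve_lengthD g' st t1).
  rewrite -(fineK f0s) -(fineK fst) -(fineK ft1) -!EFinD => -[] H.
  by rewrite !lee_fin; lra.
pose nu := arc_measure 0 1 g.
have nuP : is_arc_measure 0 1 g nu := arc_measureP tg.
have mI : measurable (`[(0 : R), 1]%classic : set (measurableTypeR R)) by [].
pose phi : measurableTypeR R -> measurableTypeR R := fun t => V t / L.
have cphi : continuous (phi : R -> R).
  by move=> x; apply: cvgM; [exact: cV|exact: cvg_cst].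
have mphi : measurable_fun setT phi by exact: continuous_measurable_fun.
pose image_measure := pushforward (mrestr nu mI) phi
  : {measure set (measurableTypeR R) -> \bar R}.
pose lam := image_measure mphi.
have lamE A : lam A = nu (phi @^-1` A `&` `[(0 : R), 1]%classic) by [].
have lamP : is_arc_measure 0 1 g' lam.
  move=> s t s0 st t1; rewrite lenE// lamE.
  have [||| a [b [a0 ab b1 [Va Vb] PE]]] := @preimage_itv_monotone V (L * s) (L * t) cV ndV.
  - by rewrite V0 mulr_ge0// ltW.
  - by rewrite ler_pM2l.
  - by rewrite -/L ler_piMr// ltW.
  rewrite (_ : _ `&` _ = `[a, b]%classic).
    by rewrite nuP// -arc_lengthB// -/V Va Vb mulrBr.
  rewrite -PE setIC; congr (_ `&` _); apply/seteqP; split => u /=;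
    by rewrite !in_itv/= /phi ler_pdivlMr// ler_pdivrMr// mulrC [t * L]mulrC.
rewrite (line_integralE rho tg' lamP) (line_integralE rho tg nuP).
rewrite (@ge0_integral_pushforward _ _ _ _ _ phi mphi (mrestr nu mI))//;
  last exact: (measurable_comp_tame tg' mrho).
rewrite (_ : phi @^-1` _ = setT); last first.
  apply/seteqP; split => // u _; rewrite /= in_itv/= /phi.
  by rewrite divr_ge0 ?Vge0 ?(ltW L0)//= ler_pdivrMr// mul1r.
rewrite ge0_integral_mrestr//.
- apply: eq_integral => u; rewrite inE/= in_itv/= => u01.
  by rewrite /= -g'E.
- have mg' : measurable_fun setT (g' : measurableTypeR R -> borel X).
    rewrite (_ : g' = g' \o clamp); first exact: measurable_tame_clamp.
    by apply/funext => t /=; rewrite -g'c.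
  exact: (measurableT_comp (measurableT_comp mrho mg') mphi).
- by move=> u; exact: rho0.
Qed.

End reparametrization.

(** * Compact and open approximation for finite Borel measures *)

Section total_boundedness.
Context {R : realType} {X : completeMetricType R}.
Implicit Types (A K : set X) (e : R).

Lemma open_mball (c : X) e : open (ball c e).
Proof.
rewrite ballEmdist openE => x /= cx.
rewrite /interior -nbhs_ballE; exists (e - mdist c x) => /=; first by rewrite subr_gt0.
move=> y; rewrite ballEmdist/= => xy.
have := metric_triangle c x y; lra.
Qed.

Lemma within_continuousP K (f : X -> R) : {within K, continuous f} <->
  forall x, K x -> forall e, 0 < e -> \forall y \near x, K y -> `|f x - f y| < e.
Proof.
have wE x : K x -> nbhs (x : subspace K) = within K (nbhs x).
  by move=> Kx; rewrite nbhs_subspace_in.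
split=> [cf x Kx e e0|H].
  have := cf x; rewrite /continuous_at wE// => /cvgrPdist_lt /(_ e e0).
  by rewrite near_withinE.
rewrite continuous_subspace_in => x /set_mem Kx; rewrite /continuous_at wE//.
have Fw : Filter (within K (nbhs x)) by exact: within_filter.
by apply/(@cvgrPdist_lt _ _ _ _ Fw) => e e0; rewrite near_withinE; exact: H.
Qed.

Lemma ultra_mem_bigcup_ball (F : set_system X) (l : seq X) e : UltraFilter F ->
  F [set x | exists2 c, c \in l & mdist c x < e] -> exists c, F (ball c e).
Proof.
move=> UF; elim: l => [|c l ih] Fl.
  by have /filter_ex[x [y]] := Fl; rewrite in_nil.
have [Fc|Fc] := in_ultra_setVsetC (ball c e) UF; first by exists c.
apply: ih; apply: filterS2 Fl Fc => x [y]; rewrite in_cons => /predU1P[->|yl] yx.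
  by rewrite ballEmdist/=.
by move=> _; exists y.
Qed.

(** An ultrafilter on a totally bounded set contains balls of all radii, so it
    is a Cauchy filter. *)
Lemma totally_bounded_closed_compact K : closed K ->
  (forall e, 0 < e -> exists l : seq X,
     K `<=` [set x | exists2 c, c \in l & mdist c x < e]) -> compact K.
Proof.
move=> cK tK; rewrite compact_ultra => F UF FK.
have PF : ProperFilter F by exact: ultra_proper.
have : cvg F.
  apply: cauchy_cvg; apply/cauchy_ballP => e e0.
  have [l Kl] := tK (e / 2) (divr_gt0 e0 (ltr0Sn R 1)).
  have [c Fc] : exists c, F (ball c (e / 2)).
    by apply: (ultra_mem_bigcup_ball (l := l)); exact: filterS FK.
  exists (ball c (e / 2), ball c (e / 2)) => //=.
  move=> [x y] /= [cx cy].
  by apply: (ball_splitr cx cy).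
move=> /cvg_ex[x Fx]; exists x; split => //.
apply: cK; rewrite closureEcvg; exists F => //; split => //.
by move=> B /= KB; apply: filterS FK.
Qed.

End total_boundedness.

Lemma measure_nonincreasing_small d (T : measurableType d) (R : realType)
    (nu : {measure set T -> \bar R}) (A : nat -> set T) (e : R) :
  (nu (A 0%N) < +oo)%E ->
  (forall n, measurable (A n)) -> (forall n m, (n <= m)%N -> A m `<=` A n) ->
  \bigcap_n A n = set0 -> 0 < e -> exists n, (nu (A n) <= e%:E)%E.
Proof.
move=> nuA0 mA ndA A0 e0.
have : nu \o A @ \oo --> nu (\bigcap_n A n).
  apply: nonincreasing_cvg_mu => //; first by rewrite A0.
  by move=> n m nm; apply/subsetPset; exact: ndA.
rewrite A0 measure0 => /fine_cvgP[fA /cvgrPdist_le/(_ e e0)] nA.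
have [n [fn]] : exists n, nu (A n) \is a fin_num /\ `|0 - fine (nu (A n))| <= e.
  by have [n [? ?]] := filter_ex (filterI fA nA); exists n.
rewrite sub0r normrN ger0_norm ?fine_ge0// => h; exists n.
by rewrite -(fineK fn) lee_fin.
Qed.

Section regularity.
Context {R : realType} {X : completeMetricType R}.
Variable nu : {measure set (borel X) -> \bar R}.
Hypothesis nuT : (nu setT < +oo)%E.
Implicit Types (A F U : set X) (e : R).

Let measurable_open U : open U -> measurable (U : set (borel X)).
Proof. by move=> oU; exact: sub_sigma_algebra. Qed.

Let measurable_closed F : closed F -> measurable (F : set (borel X)).
Proof.
move=> cF; rewrite -(setCK F); apply: measurableC; apply: measurable_open.
exact: closed_openC.
Qed.

Let nu_fin (A : set (borel X)) : measurable A -> (nu A < +oo)%E.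
Proof. by move=> mA; apply: le_lt_trans nuT; apply: le_measure; rewrite ?inE. Qed.

Lemma measure_bigcup_small (A : nat -> set (borel X)) e :
  (forall n, measurable (A n)) -> 0 < e ->
  (forall n, (nu (A n) <= (e / (2 ^ n.+1)%:R)%:E)%E) ->
  (nu (\bigcup_n A n) <= e%:E)%E.
Proof.
move=> mA e0 h; apply: le_trans (epsilon_trick0 xpredT (ltW e0)).
apply: (@le_trans _ _ (\sum_(n <oo) nu (A n))%E).
  by apply: le_mu_bigcup => //; exact: bigcup_measurable.
exact: lee_nneseries.
Qed.

Definition closed_open_regular (A : set (borel X)) := forall e, 0 < e ->
  exists F U, [/\ closed (F : set X), open (U : set X), F `<=` A, A `<=` U &
    (nu (U `\` F) <= e%:E)%E].

(** An open set is the increasing union of the closed sets of the points at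
    distance at least [1 / n] from its complement. *)
Lemma open_regular U : open U -> closed_open_regular U.
Proof.
move=> oU e e0.
pose F n : set X := [set x | forall y, mdist x y < n.+1%:R^-1 -> U y].
have cF n : closed (F n).
  rewrite (_ : F n = ~` \bigcup_(y in ~` U) ball y n.+1%:R^-1); last first.
    apply/seteqP; split => x /=.
      by move=> h [y Uy]; rewrite ballEmdist/= metric_sym => /h.
    move=> h y xy; apply: contrapT => Uy; apply: h; exists y => //.
    by rewrite ballEmdist/= metric_sym.
  by apply: open_closedC; apply: bigcup_open => y _; exact: open_mball.
have FU n : F n `<=` U by move=> x; apply; rewrite mdistxx invr_gt0.
have [||||n nuF] := @measure_nonincreasing_small _ (borel X) _ nu (fun n => U `\` F n) e _ _ _ _ e0.
- by apply/nu_fin/measurableD; [exact: measurable_open|exact: measurable_closed].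
- by move=> n; apply: measurableD; [exact: measurable_open|exact: measurable_closed].
- move=> n m nm x [Ux nF]; split => //; apply: contra_not nF => Fx y xy.
  apply: Fx; apply: lt_le_trans xy _.
  by rewrite lef_pV2 ?posrE// ler_nat.
- apply/seteqP; split => // x UF.
  have Ux : U x by have [] := UF 0%N I.
  have := open_nbhs_nbhs (conj oU Ux); rewrite -nbhs_ballE => -[d /= d0 dU].
  have [n nd] : exists n, n.+1%:R^-1 < d.
    by have [n] := ltr_add_invr d0; rewrite add0r; exists n.
  have [_] := UF n I; apply => y xy; apply: dU.
  by rewrite ballEmdist/= (lt_trans xy).
- by exists (F n), U; split.
Qed.

Lemma setC_regular A : closed_open_regular A -> closed_open_regular (~` A).
Proof.
move=> rA e /rA[F [U [cF oU FA AU h]]]; exists (~` U), (~` F); split.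
- exact: open_closedC.
- exact: closed_openC.
- exact: subsetC.
- exact: subsetC.
- by rewrite (_ : _ `\` _ = U `\` F)// !setDE setCK setIC.
Qed.

(** The union of the closed approximations need not be closed, but finitely many
    of them exhaust almost all of its measure. *)
Lemma bigcup_regular (A : nat -> set (borel X)) :
  (forall n, closed_open_regular (A n)) -> closed_open_regular (\bigcup_n A n).
Proof.
move=> rA e e0; have e20 : 0 < e / 2 by rewrite divr_gt0.
have ex n : exists FU : set X * set X, [/\ closed FU.1, open FU.2, FU.1 `<=` A n,
    A n `<=` FU.2 & (nu (FU.2 `\` FU.1) <= (e / 2 / (2 ^ n.+1)%:R)%:E)%E].
  have [|F [U H]] := rA n (e / 2 / (2 ^ n.+1)%:R); last by exists (F, U).
  by rewrite divr_gt0// ltr0n expn_gt0.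
have [FU H] := choice ex.
pose F n := (FU n).1; pose U n := (FU n).2.
have cF n : closed (F n) by have [] := H n.
have oU n : open (U n) by have [] := H n.
have FA n : F n `<=` A n by have [] := H n.
have AU n : A n `<=` U n by have [] := H n.
have nuUF n : (nu (U n `\` F n) <= (e / 2 / (2 ^ n.+1)%:R)%:E)%E by have [] := H n.
have mF n : measurable (F n : set (borel X)) by exact: measurable_closed.
have mU n : measurable (U n : set (borel X)) by exact: measurable_open.
have oUU : open (\bigcup_n U n) by apply: bigcup_open.
pose FN n : set X := \bigcup_(i < n) F i.
have cFN n : closed (FN n) by apply: closed_bigcup => //; exact: finite_II.
have [||||n nuF] := @measure_nonincreasing_small _ (borel X) _ nu (fun n => (\bigcup_n F n) `\` FN n)
  (e / 2) _ _ _ _ e20.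
- apply/nu_fin/measurableD; last exact: measurable_closed.
  exact: bigcup_measurable.
- move=> n; apply: measurableD; last exact: measurable_closed.
  exact: bigcup_measurable.
- move=> n m nm x [Ux nF]; split => //; apply: contra_not nF => -[i /= ilt Fi].
  by exists i => //=; exact: leq_trans nm.
- apply/seteqP; split => // x UF; have [[i _ Fi] _] := UF 0%N I.
  by have [_] := UF i.+1 I; apply; exists i => /=.
exists (FN n), (\bigcup_n U n); split => //.
- by move=> x [i _ Fi]; exists i => //; exact: FA.
- by move=> x [i _ Ai]; exists i => //; exact: AU.
apply: (@le_trans _ _ (nu ((\bigcup_n (U n `\` F n)) `|` ((\bigcup_n F n) `\` FN n)))).
  apply: le_measure; rewrite ?inE.
  - by apply: measurableD; [exact: measurable_open|exact: measurable_closed].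
  - apply: measurableU.
      by apply: bigcup_measurable => i _; exact: measurableD.
    by apply: measurableD; [exact: bigcup_measurable|exact: measurable_closed].
  - move=> x [[i _ Ui] nF].
    have [Fx|Fx] := pselect ((\bigcup_n F n) x); first by right.
    by left; exists i => //; split => // Fi; apply: Fx; exists i.
apply: le_trans (measureU2 _ _ _) _.
- by apply: bigcup_measurable => i _; exact: measurableD.
- by apply: measurableD; [exact: bigcup_measurable|exact: measurable_closed].
rewrite [e in leRHS](splitr e) EFinD; apply: leeD => //.
by apply: measure_bigcup_small => // i; exact: measurableD.
Qed.

Lemma measurable_regular (A : set (borel X)) : measurable A -> closed_open_regular A.
Proof.
move: A; apply: smallest_sub; last exact: open_regular.
split.
- exact/open_regular/open0.
- by move=> A /setC_regular; rewrite setTD.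
- exact: bigcup_regular.
Qed.

Hypothesis sepX : separable X.

(** Ulam's theorem. At each scale [1 / n], finitely many balls around the points
    of a dense sequence miss only a small part of the space, and the intersection
    over [n] of these finite unions is totally bounded. *)
Lemma tight e : 0 < e -> exists2 K : set X, compact K & (nu (~` K) <= e%:E)%E.
Proof.
move=> e0; have [S cS dS] := sepX.
have [c Sc] : exists c : nat -> X, S `<=` range c.
  by have /pcard_geP[c] := cS; exists c; exact: surj.
pose B n m : set X := \bigcup_(i < m) [set x | mdist (c i) x <= n.+1%:R^-1].
have cB n m : closed (B n m).
  apply: closed_bigcup; first exact: finite_II.
  move=> i _.
  rewrite (_ : [set x | _] = ~` [set x | n.+1%:R^-1 < mdist (c i) x]); last first.
    by apply/seteqP; split => x /=; rewrite leNgt => /negP.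
  apply: open_closedC; rewrite openE => x /= cx.
  rewrite /interior -nbhs_ballE; exists (mdist (c i) x - n.+1%:R^-1) => /=.
    by rewrite subr_gt0.
  move=> y; rewrite ballEmdist/= => xy.
  have := metric_triangle (c i) y x; rewrite (metric_sym y x).
  move: xy; move: n.+1%:R^-1 => a; lra.
have ex n : exists m, (nu (~` B n m) <= (e / (2 ^ n.+1)%:R)%:E)%E.
  apply: (@measure_nonincreasing_small _ (borel X) _ nu (fun m => ~` B n m)).
  - by apply/nu_fin/measurableC; exact: measurable_closed.
  - by move=> m; apply: measurableC; exact: measurable_closed.
  - by move=> m k mk; apply: subsetC => x [i /= im ix]; exists i => //=; exact: leq_trans mk.
  - apply/seteqP; split => // x H.
    have [|y [xy /Sc[i _ ciy]]] := dS (ball x n.+1%:R^-1) _ (open_mball _ _).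
      by exists x; exact: ballxx.
    have := H i.+1 I; apply; exists i => //=.
    by move: xy; rewrite ciy ballEmdist/= metric_sym => /ltW.
  - by rewrite divr_gt0// ltr0n expn_gt0.
have [m nuB] := choice ex.
exists (\bigcap_n B n (m n)); last first.
  rewrite setC_bigcap; apply: measure_bigcup_small => // n.
  by apply: measurableC; exact: measurable_closed.
apply: totally_bounded_closed_compact; first by apply: closed_bigI => n _.
move=> d d0.
have [n nd] : exists n, n.+1%:R^-1 < d
    by have [n] := ltr_add_invr d0; rewrite add0r; exists n.
exists [seq c i | i <- iota 0 (m n)] => x /(_ n I)[i /= im cix].
exists (c i); last exact: le_lt_trans nd.
by apply/mapP; exists i => //; rewrite mem_iota.
Qed.

(** Lusin's theorem. Remove the small open sets [U n `\` F n] between the open and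
    the closed approximations of the sets [f > q n], for [q] an enumeration of
    the rationals: on what remains, each of these sets is both relatively open
    and relatively closed. *)
Lemma lusin_closed (f : borel X -> R) e : measurable_fun setT f -> 0 < e ->
  exists2 S : set X, closed S & (nu (~` S) <= e%:E)%E /\ {within S, continuous (f : X -> R)}.
Proof.
move=> mf e0.
pose q n : R := ratr (odflt 0 (unpickle n) : rat).
have qex (a b : R) : a < b -> exists n, a < q n < b.
  move=> /rat_in_itvoo[r]; rewrite in_itv/= => h.
  by exists (pickle r); rewrite /q pickleK.
pose A n : set (borel X) := f @^-1` `]q n, +oo[%classic.
have mA n : measurable (A n) by rewrite -[A n]setTI; apply: mf.
have ex n : exists FU : set X * set X, [/\ closed FU.1, open FU.2, FU.1 `<=` A n,
    A n `<=` FU.2 & (nu (FU.2 `\` FU.1) <= (e / (2 ^ n.+1)%:R)%:E)%E].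
  have [|F [U H]] := measurable_regular (mA n) (e := e / (2 ^ n.+1)%:R); last by exists (F, U).
  by rewrite divr_gt0// ltr0n expn_gt0.
have [FU H] := choice ex.
pose F n := (FU n).1; pose U n := (FU n).2.
have cF n : closed (F n) by have [] := H n.
have oU n : open (U n) by have [] := H n.
have FA n : F n `<=` A n by have [] := H n.
have AU n : A n `<=` U n by have [] := H n.
have nuUF n : (nu (U n `\` F n) <= (e / (2 ^ n.+1)%:R)%:E)%E by have [] := H n.
have oUF n : open (U n `\` F n) by apply: openI => //; exact: closed_openC.
exists (~` \bigcup_n (U n `\` F n)).
  by apply: open_closedC; apply: bigcup_open.
split.
  rewrite setCK; apply: measure_bigcup_small => // n; exact: measurable_open.
apply/within_continuousP => x Sx d d0.
have [n /andP[n1 n2]] : exists n, f x - d < q n < f x by apply: qex; lra.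
have [m /andP[m1 m2]] : exists m, f x < q m < f x + d by apply: qex; lra.
have inU k y : (~` \bigcup_n (U n `\` F n)) y -> U k y -> F k y.
  by move=> Sy Uy; apply: contrapT => Fy; apply: Sy; exists k.
have Unx : nbhs x (U n).
  by apply: open_nbhs_nbhs; split => //; apply: AU; rewrite /A/= in_itv/= n2.
have Fmx : nbhs x (~` F m).
  apply: open_nbhs_nbhs; split; first exact: closed_openC.
  by move=> /FA; rewrite /A/= in_itv/= andbT ltNge (ltW m1).
apply: filterS2 Unx Fmx => y Uy Fy Sy.
have : A n y by apply/FA/inU.
rewrite /A/= in_itv/= andbT => ny.
have : ~ A m y by move=> /AU /(inU _ _ Sy).
rewrite /A/= in_itv/= andbT => /negP; rewrite -leNgt => ym.
rewrite ltr_norml; apply/andP; split; lra.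
Qed.

(** One compact set [K] takes care both of the continuity of [f] and of
    tightness, and one small set [D] contains both the excess of [V] over [E] and
    the complement of [K]. *)
Lemma compact_open_approximation (f : borel X -> R) (E : set (borel X)) e :
  measurable_fun setT f -> measurable E -> 0 < e ->
  exists K V : set X, exists D : set (borel X),
  [/\ compact K /\ {within K, continuous (f : X -> R)},
      open V /\ E `<=` V, ~` K `<=` V `&` D, measurable D /\ V `<=` E `|` D &
      (nu D <= e%:E)%E].
Proof.
move=> mf mE e0; have e30 : 0 < e / 3 by rewrite divr_gt0.
have [F [U [cF oU FE EU nuU]]] := measurable_regular mE e30.
have [K0 cK0 nuK0] := tight e30.
have [S cS [nuS fS]] := lusin_closed mf e30.
pose K := K0 `&` S.
have cK : compact K.
  apply: (subclosed_compact _ cK0); last by move=> x [].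
  by apply: closedI => //; apply: compact_closed => //; exact: metric_hausdorff.
have mK0 : measurable (~` K0 : set (borel X)).
  by apply: measurableC; apply: measurable_closed; apply: compact_closed => //; exact: metric_hausdorff.
have mS : measurable (~` S : set (borel X)) by apply: measurableC; exact: measurable_closed.
have mUF : measurable (U `\` F : set (borel X)).
  by apply: measurableD; [exact: measurable_open|exact: measurable_closed].
have mD : measurable ((U `\` F) `|` (~` K0 `|` ~` S) : set (borel X)).
  by do 2 apply: measurableU => //.
exists K, (U `|` ~` K), ((U `\` F) `|` (~` K0 `|` ~` S)); split.
- split => //; apply: continuous_subspaceW fS; by move=> x [].
- split; last by move=> x /EU; left.
  apply: openU => //; apply: closed_openC; apply: compact_closed => //.
  exact: metric_hausdorff.
- by move=> x Kx; split; right => //; rewrite -setCI.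
- split => // x [Ux|Kx]; last by right; right; rewrite -setCI.
  have [Ex|Ex] := pselect (E x); first by left.
  by right; left; split => // /FE.
- apply: le_trans (measureU2 _ _ _) _ => //; first exact: measurableU.
  have -> : e = e / 3 + (e / 3 + e / 3) by lra.
  rewrite EFinD; apply: leeD => //.
  apply: le_trans (measureU2 _ _ _) _ => //.
  by rewrite EFinD; exact: leeD.
Qed.

End regularity.

(** * Lower semicontinuity of the length inside an open set *)

Section semicontinuity.
Context {R : realType} {X : completeMetricType R}.
Implicit Types (g : R -> X) (U : set X) (s t d e : R) (l : seq R).

Definition close01 d g g' := forall t, 0 <= t -> t <= 1 -> mdist (g t) (g' t) <= d.

Lemma close01_le d d' g g' : d <= d' -> close01 d g g' -> close01 d' g g'.
Proof. by move=> dd' h t t0 t1; apply: le_trans dd'; exact: h. Qed.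

Lemma polygon_length_close d g g' s t l : 0 <= s -> t <= 1 ->
  itv_partition s t l -> close01 d g g' ->
  polygon_length g s l <= polygon_length g' s l + 2 * d * (size l)%:R.
Proof.
move=> s0 t1 + gg'; elim: l s s0 => [|x l ih] s s0 sl /=; first by rewrite mulr0 addr0.
have sx : s < x by case: sl => /= /andP[].
have xl := itv_partition_cons sl.
have xt := itv_partition_le xl.
have x0 : 0 <= x by exact: le_trans (ltW sx).
have := ih x x0 xl.
have := gg' s s0 (le_trans (ltW sx) (le_trans xt t1)).
have := gg' x x0 (le_trans xt t1).
have := metric_triangle (g s) (g' s) (g x).
have := metric_triangle (g' s) (g' x) (g x).
rewrite (metric_sym (g' x) (g x)) -[(size l).+1]addn1 natrD mulrDr mulr1; lra.
Qed.

(** The length is a supremum of polygonal lengths, each of which depends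
    continuously on the curve. *)
Lemma curve_length_lsc g s t e : tame g -> 0 <= s -> s <= t -> t <= 1 -> 0 < e ->
  exists2 d, 0 < d & forall g', close01 d g g' ->
    (curve_length s t g <= curve_length s t g' + e%:E)%E.
Proof.
move=> tg s0 st t1 e0; have fl := tame_length_fin tg s0 st t1.
have e20 : 0 < e / 2 by rewrite divr_gt0.
have [_ [l /= stl <-]] := ub_ereal_sup_adherent e20 fl.
rewrite polygon_lengthE -/(curve_length s t g) => lg.
have m0 : 0 < 4 * (size l).+1%:R :> R by rewrite mulr_gt0.
(* Moving the vertices by [d] changes a polygonal length with [size l] edges by
   at most [2 * d * size l]. *)
exists (e / (4 * (size l).+1%:R)); first by rewrite divr_gt0.
move=> g' gg'.
have h := polygon_length_close s0 t1 stl gg'.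
have h2 := polygon_length_le g' stl.
rewrite -(fineK fl) in lg *; apply: le_trans (leeD h2 (lexx _)).
move: lg; rewrite -!EFinD lte_fin lee_fin.
have : 2 * (e / (4 * (size l).+1%:R)) * (size l)%:R <= e / 2.
  rewrite mulrA mulrAC ler_pdivrMr// -[(size l).+1%:R]natr1.
  have : 0 <= (size l)%:R :> R by [].
  move: (_%:R : R) => n n0; nra.
move: h; move: (2 * _ * _) => a; lra.
Qed.

Lemma compact_in_open (K U : set X) : compact K -> open U -> K `<=` U ->
  exists2 d, 0 < d & forall x y, K x -> mdist x y <= d -> U y.
Proof.
move=> cK oU KU.
have := (compact_near_coveringP K).1 cK R (0^'+) (fun d x => forall y, mdist x y <= d -> U y).
move=> /(_ _) [].
  move=> x /KU Ux.
  have := open_nbhs_nbhs (conj oU Ux); rewrite -nbhs_ballE => -[e /= e0 eU].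
  exists (ball x (e / 2), [set d | d < e / 2]) => /=.
    split; first by apply: nbhsx_ballx; rewrite divr_gt0.
    by apply: nbhs_right_lt; rewrite divr_gt0.
  move=> [y d] /= [xy de] z yz; apply: eU; move: xy; rewrite !ballEmdist/= => xy.
  have := metric_triangle x y z; lra.
move=> e /= e0 H; exists (e / 2); first by rewrite divr_gt0.
move=> x y Kx; apply: (H (e / 2)) => //=.
- by rewrite sub0r normrN gtr0_norm ?divr_gt0// ltr_pdivrMr// ltr_pMr// ltr1n.
- by rewrite divr_gt0.
Qed.

Lemma segment_stays_in g U s t : tame g -> 0 <= s -> t <= 1 -> open U ->
  (forall u, s <= u -> u <= t -> U (g u)) ->
  exists2 d, 0 < d & forall g', close01 d g g' ->
    forall u, s <= u -> u <= t -> U (g' u).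
Proof.
move=> tg s0 t1 oU gU.
have cK : compact ((g \o clamp) @` `[s, t]%classic).
  apply: continuous_compact; last exact: segment_compact.
  exact/continuous_subspaceT/tame_continuous.
have [] := compact_in_open cK oU.
  move=> y [u /=]; rewrite in_itv/= => /andP[su ut] <-.
  by rewrite clamp_id ?(le_trans s0 su) ?(le_trans ut t1)//; exact: gU.
move=> d d0 H; exists d => // g' gg' u su ut.
have u0 := le_trans s0 su; have u1 := le_trans ut t1.
apply: (H (g u)); last exact: gg'.
by exists u; rewrite /= ?clamp_id// in_itv/= su ut.
Qed.

Definition grid n k : R := k%:R / n.+1%:R.

Lemma grid_ge0 n k : 0 <= grid n k.
Proof. by rewrite divr_ge0. Qed.

Lemma grid_le1 n k : (k <= n.+1)%N -> grid n k <= 1.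
Proof. by move=> kn; rewrite ler_pdivrMr// mul1r ler_nat. Qed.

Lemma grid_le n k m : (k <= m)%N -> grid n k <= grid n m.
Proof. by move=> km; rewrite ler_pM2r ?invr_gt0// ler_nat. Qed.

Definition good_cell g U n k :=
  forall u, grid n k <= u -> u <= grid n k.+1 -> U (g u).

Definition good_part g U n k : set (measurableTypeR R) :=
  if `[< good_cell g U n k >] then `]grid n k, grid n k.+1]%classic else set0.

Lemma measurable_good_part g U n k : measurable (good_part g U n k).
Proof. by rewrite /good_part; case: ifP. Qed.

Lemma trivIset_good_part g U n : trivIset setT (good_part g U n).
Proof.
apply/trivIsetP => i j _ _; wlog ij : i j / (i < j)%N => [W|_].
  move=> ne; have : (i != j) by [].
  rewrite neq_ltn => /orP[/W|/W]; first exact.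
  by rewrite setIC; apply; rewrite eq_sym.
rewrite /good_part; case: ifP => _; last by rewrite set0I.
case: ifP => _; last by rewrite setI0.
apply/seteqP; split => // u /= []; rewrite !in_itv/= => /andP[_ ui] /andP[ju _].
by move: (lt_le_trans ju (le_trans ui (grid_le n ij))); rewrite ltxx.
Qed.

Lemma arc_measure_itvoc g s t : tame g -> 0 <= s -> s <= t -> t <= 1 ->
  arc_measure 0 1 g `]s, t]%classic = curve_length s t g.
Proof.
move=> tg s0 st t1; have P := arc_measureP tg.
have n0 : arc_measure 0 1 g [set s] = 0%E.
  by rewrite -set_itv1 P ?curve_lengthxx// (le_trans st).
rewrite -P// -(setU1itv false) ?bnd_simp// measureU//=.
- by rewrite n0 add0e.
- by apply/seteqP; split => // x /= [->]; rewrite in_itv/= ltxx.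
Qed.

(** By continuity at [t], every cell of small mesh that contains [t] is mapped
    into [U]. The time 0 is excluded since it lies in no half-open cell. *)
Lemma eventually_good_part g U t : tame g -> open U -> 0 < t -> t <= 1 -> U (g t) ->
  exists N, forall n, (N <= n)%N -> exists2 k, (k < n.+1)%N & good_part g U n k t.
Proof.
move=> tg oU t0 t1 Ugt.
have : nbhs (g (clamp t)) U.
  by apply: open_nbhs_nbhs; split => //; rewrite clamp_id// ltW.
move=> /(tame_continuous tg) gU.
have /nbhs_ballP[d /= d0 dU] : nbhs t [set u | U (g (clamp u))] by [].
have [N Nd] : exists n, n.+1%:R^-1 < d.
  by have [n] := ltr_add_invr d0; rewrite add0r; exists n.
exists N => n Nn.
have nd : n.+1%:R^-1 < d.
  by apply: le_lt_trans Nd; rewrite lef_pV2 ?posrE// ler_nat.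
have ex : exists k, t * n.+1%:R <= k.+1%:R.
  by exists n; rewrite -[leRHS]mul1r ler_pM2r.
case: (ex_minnP ex) => k tk kmin.
have kn : (k <= n)%N by apply: kmin; rewrite -[leRHS]mul1r ler_pM2r.
exists k => //.
have kt : grid n k < t.
  rewrite ltr_pdivrMr//; case: k tk kmin {kn} => [|k] _ kmin; first by rewrite mulr_gt0.
  rewrite ltNge; apply/negP => /kmin; rewrite ltnn //.
have tk' : t <= grid n k.+1 by rewrite ler_pdivlMr.
rewrite /good_part asboolT/=; first by rewrite in_itv/= kt tk'.
move=> u ku uk.
have u0 := le_trans (grid_ge0 n k) ku.
have u1 : u <= 1 by apply: le_trans uk _; exact: grid_le1.
have := dU u; rewrite /= clamp_id//; apply.
have kk : grid n k.+1 = grid n k + n.+1%:R^-1 by rewrite /grid -natr1 mulrDl mul1r.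
move: nd tk' uk; rewrite kk; move: (n.+1%:R^-1) => a ad tk' uk.
rewrite /ball/= ltr_norml; apply/andP; split; lra.
Qed.

(** By the previous lemma, the times at which [g] is in [U] and which some grid
    finer than the [N]-th misses decrease to the empty set as [N] grows. *)
Lemma length_in_le_good g U e : tame g -> open U -> 0 < e -> exists n,
  (length_in g U <= \sum_(k < n.+1 | `[< good_cell g U n k >])
     curve_length (grid n k) (grid n k.+1) g + e%:E)%E.
Proof.
move=> tg oU e0.
pose mu := arc_measure 0 1 g.
pose O : set (measurableTypeR R) := `]0%R, 1%R]%classic `&` (g @^-1` U).
have mU : measurable (U : set (borel X)) by exact: sub_sigma_algebra.
have IE : (`[0%R, 1%R]%classic : set (measurableTypeR R)) = [set 0] `|` `]0, 1]%classic.
  by rewrite (setU1itv false) ?bnd_simp.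
have mO : measurable O.
  rewrite (_ : O = `]0%R, 1%R]%classic `&` (`[0%R, 1%R]%classic `&` g @^-1` U)).
    by apply: measurableI => //; exact: measurable_tame_preimage.
  by rewrite setIA; congr (_ `&` _); rewrite setIidl// IE; right.
pose A n : set (measurableTypeR R) := \big[setU/set0]_(k < n.+1) good_part g U n k.
have mA n : measurable (A n) by apply: bigsetU_measurable => k _; exact: measurable_good_part.
have AP n t : A n t <-> exists2 k, (k < n.+1)%N & good_part g U n k t.
  by rewrite /A -(bigcup_mkord n.+1 (good_part g U n)); split=> -[k kn h]; exists k.
pose C N := O `\` \bigcap_(n in [set n | (N <= n)%N]) A n.
have mC N : measurable (C N).
  by apply: measurableD => //; apply: bigcap_measurableType => n _.
have [||||N muC] := @measure_nonincreasing_small _ _ _ mu C e _ _ _ _ e0.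
- apply: (@le_lt_trans _ _ (mu `]0%R, 1%R]%classic)).
    by apply: le_measure; rewrite ?inE// => t [[]].
  by rewrite /mu arc_measure_itvoc ?ler01 -?ge0_fin_numE ?curve_length_ge0 ?tame_length_fin ?ler01.
- exact: mC.
- move=> n m nm t [Ot nA]; split => //; apply: contra_not nA => h k /= mk.
  by apply: h => /=; exact: leq_trans mk.
- apply/seteqP; split => // t CO.
  have [[+ Ut] _] := CO 0%N I; rewrite /= in_itv/= => /andP[t0 t1].
  have [N HN] := eventually_good_part tg oU t0 t1 Ut.
  by have [_] := CO N I; apply => n /= /HN h; apply/AP.
exists N.
have -> : (\sum_(k < N.+1 | `[< good_cell g U N k >])
     curve_length (grid N k) (grid N k.+1) g = mu (A N))%E.
  rewrite /A measure_bigsetU//; last 2 first.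
  - by move=> k; exact: measurable_good_part.
  - exact: trivIset_good_part.
  rewrite big_mkcond/=; apply: eq_bigr => k _; rewrite /good_part.
  case: ifP => _; last by rewrite measure0.
  by rewrite /mu arc_measure_itvoc ?grid_ge0 ?grid_le ?grid_le1.
apply: (@le_trans _ _ (mu ([set 0] `|` (A N `|` C N)))).
  apply: le_measure; rewrite ?inE.
  - exact: measurable_tame_preimage.
  - by do 2 apply: measurableU => //.
  move=> t [+ Ut]; rewrite IE => -[t0|t01]; first by left.
  have Ot : O t by [].
  have [Ct|Ct] := pselect (C N t); first by right; right.
  right; left; apply: contrapT => At; apply: Ct; split => // h.
  by apply: At; apply: h => /=.
apply: le_trans (measureU2 _ _ _) _ => //; first exact: measurableU.
have mu0 : (mu [set 0%R] <= 0)%E.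
  by rewrite -set_itv1 /mu (arc_measureP tg)// curve_lengthxx.
apply: le_trans (leeD mu0 (lexx _)) _; rewrite add0e; apply: le_trans (measureU2 _ _ _) _ => //.
exact: leeD.
Qed.

Lemma good_le_length_in g g' U n : tame g' -> open U ->
  (forall k, (k < n.+1)%N -> good_cell g U n k -> good_cell g' U n k) ->
  (\sum_(k < n.+1 | `[< good_cell g U n k >])
     curve_length (grid n k) (grid n k.+1) g' <= length_in g' U)%E.
Proof.
move=> tg' oU H.
have mU : measurable (U : set (borel X)) by exact: sub_sigma_algebra.
have -> : (\sum_(k < n.+1 | `[< good_cell g U n k >])
     curve_length (grid n k) (grid n k.+1) g' =
   arc_measure 0 1 g' (\big[setU/set0]_(k < n.+1) good_part g U n k))%E.
  rewrite measure_bigsetU//; last 2 first.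
  - by move=> k; exact: measurable_good_part.
  - exact: trivIset_good_part.
  rewrite big_mkcond/=; apply: eq_bigr => k _; rewrite /good_part.
  case: ifP => _; last by rewrite measure0.
  by rewrite arc_measure_itvoc ?grid_ge0 ?grid_le ?grid_le1.
apply: le_measure; rewrite ?inE.
- by apply: bigsetU_measurable => k _; exact: measurable_good_part.
- exact: measurable_tame_preimage.
rewrite -(bigcup_mkord n.+1 (good_part g U n)) => t [k /= kn].
rewrite /good_part; case: ifP => // /asboolP gk /=; rewrite in_itv/= => /andP[kt tk].
split; first by rewrite /= in_itv/= (le_trans (grid_ge0 n k) (ltW kt)) (le_trans tk (grid_le1 _)).
by apply: H gk _ (ltW kt) tk.
Qed.

Lemma exists_common_radius m (P : nat -> R -> Prop) :
  (forall k d d', d <= d' -> P k d' -> P k d) ->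
  (forall k, (k < m)%N -> exists2 d, 0 < d & P k d) ->
  exists2 d, 0 < d & forall k, (k < m)%N -> P k d.
Proof.
move=> mono; elim: m => [|m ih] H; first by exists 1.
have [|d d0 dP] := ih; first by move=> k km; apply: H; rewrite ltnS ltnW.
have [d' d'0 d'P] := H m (ltnSn m).
exists (Order.min d d'); first by rewrite lt_min d0.
move=> k; rewrite ltnS leq_eqVlt => /predU1P[->|km].
  by apply: mono d'P; rewrite ge_min lexx orbT.
by apply: mono (dP _ km); rewrite ge_min lexx.
Qed.

(** Up to [e / 2], the length of [g] in [U] is the length over finitely many cells
    that [g] maps into [U]. A uniformly close curve maps these cells into [U] as
    well, and is not much shorter on any of them. *)
Lemma length_in_lsc g U e : tame g -> open U -> 0 < e ->
  exists2 d, 0 < d & forall g', tame g' -> close01 d g g' ->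
    (length_in g U <= length_in g' U + e%:E)%E.
Proof.
move=> tg oU e0; have e20 : 0 < e / 2 by rewrite divr_gt0.
have [n gn] := length_in_le_good tg oU e20.
have en0 : 0 < e / 2 / n.+1%:R by rewrite divr_gt0.
have [|k kn|d d0 dP] := @exists_common_radius n.+1 (fun k d => forall g', close01 d g g' ->
    (good_cell g U n k -> good_cell g' U n k) /\
    (curve_length (grid n k) (grid n k.+1) g <=
     curve_length (grid n k) (grid n k.+1) g' + (e / 2 / n.+1%:R)%:E)%E).
- by move=> k d d' dd' H g' /(close01_le dd'); exact: H.
- have [d1 d10 H1] := curve_length_lsc tg (grid_ge0 n k) (grid_le n (leqnSn k)) (grid_le1 kn) en0.
  have [gk|gk] := pselect (good_cell g U n k); last first.
    by exists d1 => // g' gg'; split => //; exact: H1.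
  have [d2 d20 H2] := segment_stays_in tg (grid_ge0 n k) (grid_le1 kn) oU gk.
  exists (Order.min d1 d2); first by rewrite lt_min d10.
  move=> g' gg'; split=> [_|].
    by apply: H2; apply: close01_le gg'; rewrite ge_min lexx orbT.
  by apply: H1; apply: close01_le gg'; rewrite ge_min lexx.
exists d => // g' tg' gg'.
apply: (le_trans gn).
rewrite [e in leRHS](splitr e) EFinD addeA; apply: leeD => //.
apply: (@le_trans _ _ (\sum_(k < n.+1 | `[< good_cell g U n k >])
  (curve_length (grid n k) (grid n k.+1) g' + (e / 2 / n.+1%:R)%:E))%E).
  by apply: lee_sum => k _; have [] := dP k (ltn_ord k) g' gg'.
rewrite big_split/=; apply: leeD.
  by apply: good_le_length_in => // k kn; have [] := dP k kn g' gg'.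
apply: (@le_trans _ _ (\sum_(k < n.+1) (e / 2 / n.+1%:R)%:E)%E).
  have en0' : (0 <= (e / 2 / n.+1%:R)%:E)%E by rewrite lee_fin ltW.
  by apply: lee_sum_nneg_subset.
by rewrite sumEFin lee_fin sumr_const card_ord -[leLHS]mulr_natr divfK.
Qed.

End semicontinuity.

(** * A compact family of Lipschitz curves *)

Section compact_family.
Context {R : realType} {X : completeMetricType R}.
Implicit Types (g h : R -> X) (s t d e : R).

Lemma closed_mdist_limit (K : set X) x : closed K ->
  (forall e, 0 < e -> exists2 y, K y & mdist x y <= e) -> K x.
Proof.
move=> cK H; apply: cK => B /nbhs_ballP[e /= e0 eB].
have [y Ky xy] := H (e / 2) (divr_gt0 e0 (ltr0Sn R 1)).
exists y; split => //; apply: eB; rewrite ballEmdist/=.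
by apply: le_lt_trans xy _; rewrite ltr_pdivrMr// ltr_pMr// ltr1n.
Qed.

Lemma compact_totally_bounded (Q : set X) e : compact Q -> 0 < e ->
  exists l : seq X, Q `<=` [set x | exists2 c, c \in l & mdist c x < e].
Proof.
rewrite compact_cover => cQ e0.
have [|x Qx|D _ QD] := cQ X setT (fun c => ball c e).
- by move=> c _; exact: open_mball.
- by exists x => //; exact: ballxx.
- exists (finmap.enum_fset D) => x /QD[c /= cD]; rewrite ballEmdist/= => cx.
  by exists c.
Qed.

Lemma precompact_totally_bounded (P : set X) :
  (forall e, 0 < e -> exists l : seq X,
     P `<=` [set x | exists2 c, c \in l & mdist c x <= e]) -> precompact P.
Proof.
move=> tP; rewrite precompactE; apply: totally_bounded_closed_compact.
  exact: closed_closure.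
move=> e e0; have e40 : 0 < e / 4 by rewrite divr_gt0.
have [l Pl] := tP _ e40; exists l => x clx.
have [y [/Pl[c cl cy]]] := clx _ (nbhsx_ballx x _ e40).
rewrite ballEmdist/= => xy; exists c => //.
have := metric_triangle c y x; rewrite (metric_sym y x); lra.
Qed.

(** Between its last visit to [K] before the time [t] and the time [t], the curve
    remains in [V]. *)
Lemma mdist_last_exit g (K : set X) (V : set X) e t : tame g -> closed K ->
  open V -> ~` K `<=` V -> K (g 0) -> 0 <= t -> t <= 1 ->
  (length_in g V <= e%:E)%E -> exists2 q, K q & mdist q (g t) <= e.
Proof.
move=> tg cK oV KV Kg0 t0 t1 ge.
pose S := `[0, t]%classic `&` (g \o clamp) @^-1` K.
have cS : compact S.
  apply: (subclosed_compact _ (@segment_compact _ 0 t)); last by move=> u [].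
  apply: closedI; first exact: interval_closed.
  by apply: closed_comp => // x _; exact: tame_continuous.
have S0 : S !=set0.
  by exists 0; split; rewrite /= ?in_itv/= ?lexx// clamp_id ?ler01.
have cid : {within S, continuous (@idfun R)}.
  by apply: continuous_subspaceT => x; exact: cvg_id.
have [s /set_mem Ss smax] := compact_EVT_max S0 cS cid.
have [] := Ss; rewrite /= in_itv/= => /andP[s0 st].
have s1 := le_trans st t1.
rewrite clamp_id// => Kgs; exists (g s) => //.
rewrite -lee_fin; apply: le_trans ge.
apply: le_trans (mdist_le_curve_length g st) _.
rewrite -arc_measure_itvoc//; apply: le_measure; rewrite ?inE//.
  apply: measurable_tame_preimage => //; exact: sub_sigma_algebra.
move=> u /=; rewrite in_itv/= => /andP[su ut].
have u0 := le_trans s0 (ltW su); have u1 := le_trans ut t1.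
rewrite in_itv/= u0 u1; split => //; apply: KV => Ku.
have : u <= s; last by rewrite leNgt su.
by apply: smax; rewrite inE; split; rewrite /= ?in_itv/= ?u0 ?ut// clamp_id.
Qed.

Variables (f : X -> R) (x0 : X) (L c : R) (K : set X) (V C : nat -> set X).

(** The last condition says that the line integral of
    [c * \sum_(l <oo) \1_(V l)], increased by [c], is at most
    [`|f (g 1) - f (g 0)|]. A non-strict inequality between real numbers is
    stable under uniform limits, and finite sums allow to argue set by set. *)
Definition tight_family : set (R -> X) := [set g |
  [/\ forall t, g t = g (clamp t),
      forall s t, 0 <= s -> s <= t -> t <= 1 -> mdist (g s) (g t) <= L * (t - s),
      mdist x0 (g 0) <= L, K (g 0) /\ K (g 1) &
      forall m, c * (\sum_(l < m) fine (length_in g (V l))) + c <=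
        `|f (g 1) - f (g 0)|]].

Hypotheses (L0 : 0 < L) (c0 : 0 < c).
Hypotheses (cK : compact K) (fK : {within K, continuous f}).
Hypotheses (oV : forall l, open (V l)) (cC : forall l, compact (C l)).
Hypothesis CV : forall l, ~` C l `<=` V l.

Let closed_cpt (A : set X) : compact A -> closed A.
Proof. by move=> cA; apply: compact_closed => //; exact: metric_hausdorff. Qed.

Lemma tight_family_tame g : tight_family g -> tame g.
Proof. by move=> [_ gL _ _ _]; exact: lipschitz_tame gL. Qed.

Lemma tight_family_lipschitz g s t : tight_family g ->
  mdist (g s) (g t) <= L * `|s - t|.
Proof.
move=> [gc gL _ _ _]; wlog st : s t / s <= t => [W|].
  by have [/W//|/ltW/W] := leP s t; rewrite metric_sym distrC.
rewrite gc (gc t); apply: le_trans (gL _ _ _ _ _) _.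
- exact: clamp_ge0.
- exact: le_clamp.
- exact: clamp_le1.
- rewrite ler_pM2l//; apply: le_trans (ler_norm _) _.
  by rewrite distrC clamp_lipschitz.
Qed.

Let measV l : measurable (V l : set (borel X)).
Proof. exact: sub_sigma_algebra. Qed.

Let length_inK g l : tame g -> ((fine (length_in g (V l)))%:E = length_in g (V l))%E.
Proof. by move=> tg; rewrite fineK// length_in_fin. Qed.

Lemma bounded_on_compact : exists2 M : R, 0 < M & forall x, K x -> `|f x| <= M.
Proof.
have : bounded_set (f @` K) by exact/compact_bounded/continuous_compact.
move=> [M [Mr HM]]; exists (`|M| + 1); first by rewrite ltr_wpDl.
by move=> x Kx; apply: HM; [rewrite (le_lt_trans (ler_norm _))// ltrDl|exists x].
Qed.

(** As [f] is bounded on [K], the sum over [l] of the lengths of [g] outside [C l]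
    is bounded on the family. Hence among sufficiently many indices [l] there is
    one for which [g] has little length outside [C l], and then [g] stays close
    to the compact set [K `|` C l]. The finite union of all these sets does not
    depend on [g]. *)
Lemma tight_family_range_precompact :
  precompact [set x | exists2 g, tight_family g & exists t, x = g t].
Proof.
apply: precompact_totally_bounded => e e0.
have e20 : 0 < e / 2 by rewrite divr_gt0.
have [M M0 fM] := bounded_on_compact.
(* If [n] of the lengths exceeded [e / 2], their sum would exceed its bound
   [2 * M / c]. *)
pose n := (Num.truncn (2 * M / c / (e / 2))).+1.
have nM : 2 * M / c < n%:R * (e / 2).
  by rewrite -ltr_pdivrMr// Num.Theory.truncnS_gt.
pose Q : set X := K `|` \big[setU/set0]_(l < n) C l.
have cQ : compact Q by apply: compactU => //; exact: bigsetU_compact.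
have [l Ql] := compact_totally_bounded cQ e20.
exists l => _ [g Fg [t ->]].
have tg := tight_family_tame Fg.
have [gc gL _ [Kg0 Kg1] gV] := Fg.
have [k kn gk] : exists2 k, (k < n)%N & fine (length_in g (V k)) <= e / 2.
  apply: contrapT => H.
  have : n%:R * (e / 2) <= \sum_(k < n) fine (length_in g (V k)).
    apply: (@le_trans _ _ (\sum_(k < n) (e / 2))).
      by rewrite sumr_const card_ord mulr_natl.
    apply: ler_sum => k _; rewrite leNgt; apply/negP => kn; apply: H.
    by exists k => //; exact: ltW.
  move: (gV n); set S := \sum_(k < n) _ => h1 h2.
  have h3 : `|f (g 1) - f (g 0)| <= 2 * M.
    apply: le_trans (ler_normB _ _) _.
    by rewrite mulr_natl mulr2n lerD// fM.
  have h4 : c * S <= 2 * M.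
    by apply: le_trans h3; apply: le_trans h1; rewrite lerDl ltW.
  have h5 : S <= 2 * M / c by rewrite ler_pdivlMr// mulrC.
  by move: (le_lt_trans (le_trans h2 h5) nM); rewrite ltxx.
have [q Qq qg] : exists2 q, Q q & mdist q (g (clamp t)) <= e / 2.
  have [|||||||q [Kq|Cq] qg] := @mdist_last_exit g (K `|` C k) (V k) (e / 2) (clamp t) tg.
  - by apply: closedU; exact: closed_cpt.
  - exact: oV.
  - by move=> x /not_orP[_ /CV].
  - by left.
  - exact: clamp_ge0.
  - exact: clamp_le1.
  - by rewrite -length_inK// lee_fin.
  - by exists q => //; left.
  - by exists q => //; right; rewrite -(bigcup_mkord n C); exists k.
have [y yl yq] := Ql _ Qq; exists y => //.
have := metric_triangle y q (g (clamp t)); rewrite [g t]gc; lra.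
Qed.

(** The right-hand side of the last condition is continuous because the end
    points stay in [K]; its left-hand side is lower semicontinuous. *)
Lemma tight_family_closed g : (forall t, g t = g (clamp t)) ->
  (forall e, 0 < e -> exists2 h, tight_family h & close01 e g h) ->
  tight_family g.
Proof.
move=> gc H.
have gL s t : 0 <= s -> s <= t -> t <= 1 -> mdist (g s) (g t) <= L * (t - s).
  move=> s0 st t1; apply/ler_addgt0Pr => e e0.
  have [h [_ hL _ _ _] gh] := H (e / 2) (divr_gt0 e0 (ltr0Sn R 1)).
  have := hL s t s0 st t1.
  have := gh s s0 (le_trans st t1); have := gh t (le_trans s0 st) t1.
  have := metric_triangle (g s) (h s) (g t).
  have := metric_triangle (h s) (h t) (g t); rewrite (metric_sym (h t) (g t)).
  by move: (L * _) => a; lra.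
have tg : tame g by exact: lipschitz_tame gL.
have K0 : K (g 0).
  apply: closed_mdist_limit; first exact: closed_cpt.
  by move=> e /H[h [_ _ _ [Kh0 _] _] gh]; exists (h 0) => //; exact: gh.
have K1 : K (g 1).
  apply: closed_mdist_limit; first exact: closed_cpt.
  by move=> e /H[h [_ _ _ [_ Kh1] _] gh]; exists (h 1) => //; exact: gh.
split => //.
  apply/ler_addgt0Pr => e /H[h [_ _ hx _ _] gh].
  have := gh 0 (lexx 0) ler01; have := metric_triangle x0 (h 0) (g 0).
  rewrite (metric_sym (h 0) (g 0)); lra.
move=> m; apply/ler_addgt0Pr => e e0.
have e30 : 0 < e / 3 by rewrite divr_gt0.
(* The errors on the [m] lengths, multiplied by [c], add up to at most [e / 3]. *)
pose e1 : R := e / 3 / (c * m.+1%:R).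
have e10 : 0 < e1 by rewrite divr_gt0// mulr_gt0.
have fnear x : K x -> exists2 d, 0 < d & forall y, K y -> mdist x y <= d -> `|f x - f y| < e / 3.
  move=> Kx; have := (within_continuousP K f).1 fK x Kx _ e30.
  move=> /nbhs_ballP[d /= d0 dP]; exists (d / 2); first by rewrite divr_gt0.
  move=> y Ky xy; apply: dP => //; rewrite ballEmdist/=; apply: le_lt_trans xy _.
  by rewrite ltr_pdivrMr// ltr_pMr// ltr1n.
have [d0 d00 f0] := fnear _ K0.
have [d1 d10 f1] := fnear _ K1.
have [|k _|d2 d20 dV] := @exists_common_radius R m (fun k d => forall h, tame h ->
   close01 d g h -> (length_in g (V k) <= length_in h (V k) + e1%:E)%E).
- by move=> k d d' dd' P h th gh; apply: P => //; exact: close01_le gh.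
- exact: length_in_lsc.
pose d := Order.min d0 (Order.min d1 d2).
have [h Fh gh] : exists2 h, tight_family h & close01 d g h.
  by apply: H; rewrite !lt_min d00 d10.
have th := tight_family_tame Fh.
have [_ _ _ [Kh0 Kh1] hV] := Fh.
have := f0 _ Kh0 _; have := f1 _ Kh1 _.
move=> /(_ (le_trans (gh 1 ler01 (lexx 1)) _)); rewrite !ge_min lexx orbT => /(_ isT) F1.
move=> /(_ (le_trans (gh 0 (lexx 0) ler01) _)); rewrite ge_min lexx => /(_ isT) F0.
have hm := hV m.
have S : \sum_(l < m) fine (length_in g (V l)) <=
    \sum_(l < m) fine (length_in h (V l)) + m%:R * e1.
  rewrite mulr_natl -[X in e1 *+ X]card_ord -sumr_const -big_split/=.
  apply: ler_sum => l _; rewrite -lee_fin EFinD !length_inK//.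
  apply: dV => //; apply: close01_le gh.
  by rewrite !ge_min lexx !orbT.
have ce : c * (m%:R * e1) <= e / 3.
  have <- : c * (m.+1%:R * e1) = e / 3.
    by rewrite mulrA mulrC /e1; apply: divfK; rewrite gt_eqF// mulr_gt0.
  by rewrite ler_pM2l// ler_pM2r// ler_nat.
have cS : c * \sum_(l < m) fine (length_in g (V l)) <=
    c * (\sum_(l < m) fine (length_in h (V l)) + m%:R * e1) by rewrite ler_pM2l.
rewrite mulrDr in cS.
have ft : `|f (h 1) - f (h 0)| <= `|f (g 1) - f (g 0)| + (e / 3 + e / 3).
  have -> : f (h 1) - f (h 0) = (f (g 1) - f (g 0)) - ((f (g 1) - f (h 1)) - (f (g 0) - f (h 0))).
    by ring.
  apply: le_trans (ler_normB _ _) _; apply: lerD => //.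
  by apply: le_trans (ler_normB _ _) _; apply: lerD; exact: ltW.
apply: le_trans (lerD cS (lexx c)) _.
have -> : e = e / 3 + e / 3 + e / 3 by lra.
by rewrite addrAC addrA; apply: lerD => //; exact: le_trans hm ft.
Qed.

Lemma tight_family_equicontinuous : equicontinuous tight_family id.
Proof.
move=> t E; rewrite -entourage_ballE => -[e /= e0 eE].
near=> s => g Fg; apply: eE => /=; rewrite ballEmdist/=.
apply: le_lt_trans (tight_family_lipschitz _ _ Fg) _.
rewrite mulrC -ltr_pdivlMr//; near: s.
by apply: nbhsx_ballx; rewrite divr_gt0.
Unshelve. all: by end_near. Qed.

(** Arzela-Ascoli. The limit is composed with [clamp] in order to be constant
    outside [0, 1]; this does not affect uniform convergence on [0, 1]. *)
Lemma tight_family_compact : compact01 tight_family.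
Proof.
have pF : precompact (tight_family : set {family compact, R -> X}).
  apply: pointwise_precompact_equicontinuous.
  - exact: metric_hausdorff.
  - move=> t; apply: precompact_subset tight_family_range_precompact.
    by move=> _ [g Fg <-]; exists g => //; exists t.
  - exact: tight_family_equicontinuous.
rewrite /compact01 compact_ultra => F UF FF.
move: pF; rewrite precompactE compact_ultra => /(_ F UF) [].
  apply: filterS FF.
  exact: (@subset_closure {family compact, R -> X} tight_family).
move=> h [_ /fam_cvgP/(_ `[(0 : R), 1]%classic (@segment_compact _ 0 1))].
move=> Fh; pose g := h \o clamp.
have Fg e : 0 < e -> F [set g' | close01 e g g'].
  move=> e0; apply: Fh; apply/uniform_nbhs.
  exists [set xy | mdist xy.1 xy.2 < e]; split.
    rewrite -entourage_ballE; exists e => //= -[x y] /=.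
    by rewrite ballEmdist.
  move=> g' gg' t t0 t1; rewrite /g/= clamp_id// ltW//.
  by apply: (gg' t); rewrite /= in_itv/= t0.
exists g; split.
  apply: tight_family_closed => [t|e e0]; first by rewrite /g/= clampK.
  have [g' [Fg' gg']] := filter_ex (filterI FF (Fg e e0)).
  by exists g'.
move=> P /uniform_nbhs[E [+ EP]]; rewrite -entourage_ballE => -[e /= e0 eE].
have := Fg (e / 2) (divr_gt0 e0 (ltr0Sn R 1)).
apply: filterS => g' gg'; apply: EP => t /=; rewrite in_itv/= => /andP[t0 t1].
apply: eE => /=; rewrite ballEmdist/=; apply: le_lt_trans (gg' t t0 t1) _.
by rewrite ltr_pdivrMr// ltr_pMr// ltr1n.
Qed.

End compact_family.

(** * Layer cake sums over level sets *)

Section level_sets.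
Context {R : realType} (T : Type).
Local Open Scope ereal_scope.
Implicit Types (rho : T -> \bar R) (d : R) (x : T).

Definition level_set rho d k : set T := [set x | (k%:R * d)%:E < rho x].

Lemma indic_ge0 (A : set T) x : 0 <= (\1_A x)%:E :> \bar R.
Proof. by rewrite lee_fin. Qed.

(** If [n * d < rho x], then [x] is in the first [n.+1] level sets. This improves
    the bound [n * d] to [n.+1 * d], which contradicts the choice of [n] as the
    integer part of the sum. *)
Lemma level_sum_ge rho d x : (0 < d)%R -> 0 <= rho x ->
  rho x <= d%:E * \sum_(k <oo) (\1_(level_set rho d k) x)%:E.
Proof.
move=> d0 r0; set S := \sum_(k <oo) _.
have I0 k : 0 <= (\1_(level_set rho d k) x)%:E :> \bar R by exact: indic_ge0.
have S0 : 0 <= S by apply: nneseries_ge0.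
have H n : (n%:R * d)%:E < rho x -> (n.+1%:R * d)%:E <= d%:E * S.
  move=> nd; rewrite mulrC EFinM lee_pmul2l//.
  apply: le_trans (nneseries_lim_ge n.+1 _) => //.
  rewrite (eq_big_nat _ _ (F2 := fun=> 1%:E)) ?sumEFin.
    by rewrite lee_fin sumr_const_nat subn0.
  move=> k /andP[_ kn]; rewrite indicE mem_set//=.
  apply: le_lt_trans nd; rewrite lee_fin ler_pM2r// ler_nat.
  by rewrite -ltnS.
rewrite leNgt; apply/negP => Sr.
have dS0 : 0 <= d%:E * S by rewrite mule_ge0// lee_fin ltW.
have dSf : d%:E * S \is a fin_num by rewrite ge0_fin_numE// (lt_le_trans Sr) ?leey.
move: dSf dS0 Sr H => /fineK <-; set s := fine _; rewrite lee_fin => s0 Sr H.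
have sd0 : (0 <= s / d)%R by rewrite divr_ge0// ltW.
have /andP[n1 n2] := Num.Theory.truncn_itv sd0.
have := H (Num.truncn (s / d)); rewrite !lee_fin -ler_pdivlMr// leNgt n2 => /(_ _)/negP.
apply => //; apply: le_lt_trans Sr; rewrite lee_fin -ler_pdivlMr//.
Qed.

Lemma level_sum_le rho d x : (0 < d)%R -> 0 <= rho x ->
  d%:E * \sum_(k <oo) (\1_(level_set rho d k) x)%:E <= rho x + d%:E.
Proof.
move=> d0 r0.
have I0 k : 0 <= (\1_(level_set rho d k) x)%:E :> \bar R by exact: indic_ge0.
rewrite -nneseriesZl//; apply: lime_le.
  by apply: is_cvg_nneseries => k _ _; rewrite mule_ge0// lee_fin ltW.
apply: nearW; elim => [|m ih].
  by rewrite big_geq// adde_ge0// lee_fin ltW.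
have [xm|xm] := pselect (level_set rho d m x); last first.
  by rewrite big_nat_recr//= indicE memNset// mule0 adde0.
apply: (@le_trans _ _ (m.+1%:R * d)%:E); last first.
  rewrite -natr1 mulrDl mul1r.
  by rewrite EFinD; apply: leeD => //; exact: ltW.
rewrite -ge0_sume_distrr// sumEFin -EFinM lee_fin mulrC ler_pM2r//.
apply: (@le_trans _ _ (\sum_(0 <= k < m.+1) 1)%R).
  by apply: ler_sum => k _; rewrite indicE; case: (_ \in _).
by rewrite sumr_const_nat subn0.
Qed.

Lemma indic_sum_fin_eventually_notin (D : nat -> set T) x :
  \sum_(k <oo) (\1_(D k) x)%:E < +oo :> \bar R ->
  exists N, forall k, (N <= k)%N -> ~ D k x.
Proof.
move=> Dfin.
have I0 k : 0 <= (\1_(D k) x)%:E :> \bar R by exact: indic_ge0.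
have /fine_cvgP[fN /cvgrPdist_lt/(_ 1%R ltr01)] :=
  nneseries_tail_cvg Dfin (fun k _ => I0 k).
move=> /(filterI fN)[N _ HN]; exists N => k Nk Dk.
have [/= fk] := HN k Nk.
rewrite sub0r normrN ger0_norm ?fine_ge0 ?nneseries_ge0//.
rewrite -lte_fin fineK// ltNge => /negP; apply.
apply: le_trans (@nneseries_lim_ge _ _ xpredT k k.+1 _) => //.
by rewrite big_nat1 indicE mem_set.
Qed.

End level_sets.

Section counting_function.
Context {R : realType} {X : completeMetricType R}.
Variables (mu : {measure set (borel X) -> \bar R}) (p : R).
Hypothesis p0 : 0 < p.
Variable D : nat -> nat -> set (borel X).
Hypothesis mD : forall j k, measurable (D j k).
Hypothesis muD : forall j k, (mu (D j k) <=
  (((2 ^ j.+1)%:R * (2 ^ k.+1)%:R * k.+1%:R `^ p)^-1)%:E)%E.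
Local Open Scope ereal_scope.

(** Finite at [x] only if, for each [j], the point [x] lies in finitely many of the
    sets [D j k]. *)
Definition sup_count (x : borel X) : \bar R :=
  esups (fun j => \sum_(k <oo) (\1_(D j k) x)%:E) 0%N.

Let I0 j k x : 0 <= (\1_(D j k) x)%:E :> \bar R. Proof. exact: indic_ge0. Qed.

Let mI j k : measurable_fun setT (fun x => (\1_(D j k) x)%:E : \bar R).
Proof. exact/measurable_EFinP/measurable_indic. Qed.

Let mN j : measurable_fun setT (fun x => \sum_(k <oo) (\1_(D j k) x)%:E : \bar R).
Proof. by apply: ge0_emeasurable_sum => // k x _ _; exact: I0. Qed.

Lemma measurable_sup_count : measurable_fun setT sup_count.
Proof. exact: (measurable_fun_esups mN). Qed.

Lemma sup_count_ge j x : \sum_(k <oo) (\1_(D j k) x)%:E <= sup_count x.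
Proof. exact: (esups_ge_term (fun j => \sum_(k <oo) (\1_(D j k) x)%:E)). Qed.

Lemma sup_count_ge0 x : 0 <= sup_count x.
Proof. by apply: le_trans (sup_count_ge 0%N x); apply: nneseries_ge0. Qed.

(** The [p]-th power is at most the double sum of [k.+1 ^ p * \1_(D j k)], whose
    integral is at most a double geometric series. *)
Lemma sup_count_integrable : \int[mu]_x (sup_count x `^ p) < +oo.
Proof.
pose a k := (k.+1%:R `^ p)%:E : \bar R.
have a0 k : 0 <= a k by rewrite lee_fin powR_ge0.
have T0 j k x : 0 <= a k * (\1_(D j k) x)%:E by rewrite mule_ge0.
have mT j k : measurable_fun setT (fun x => a k * (\1_(D j k) x)%:E).
  exact: (@emeasurable_funM _ _ _ setT (cst (a k))).
have mS j : measurable_fun setT (fun x => \sum_(k <oo) a k * (\1_(D j k) x)%:E).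
  by apply: ge0_emeasurable_sum => // k x _ _; exact: T0.
apply: (@le_lt_trans _ _ (\int[mu]_x (\sum_(j <oo) \sum_(k <oo) a k * (\1_(D j k) x)%:E))).
  apply: ge0_le_integral => //.
  - by move=> x _; exact: poweR_ge0.
  - exact: (measurableT_comp (measurable_poweR p) measurable_sup_count).
  - by apply: ge0_emeasurable_sum => // j x _ _; apply: nneseries_ge0.
  - move=> x _; apply: le_trans (esups_poweR_le p0 _) _.
      by move=> j; apply: nneseries_ge0.
    apply: lee_nneseries => // j _; first by move=> _; exact: poweR_ge0.
    exact: (indic_sum_poweR_le (fun k => D j k) x p0).
rewrite integral_nneseries//; last by move=> j x _; apply: nneseries_ge0.
apply: (@le_lt_trans _ _ 1%:E); last exact: ltry.
apply: le_trans (epsilon_trick0 xpredT ler01).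
apply: lee_nneseries => [j _ _|j _].
  by apply: integral_ge0 => x _; apply: nneseries_ge0.
rewrite integral_nneseries//.
apply: le_trans (epsilon_trick0 xpredT (_ : 0 <= 1 / (2 ^ j.+1)%:R)%R); last first.
  by rewrite divr_ge0.
apply: lee_nneseries => [k _ _|k _].
  by apply: integral_ge0 => x _; exact: T0.
rewrite ge0_integralZl// integral_indic// setIT.
apply: le_trans (lee_wpmul2l (a0 k) (muD j k)) _.
rewrite -EFinM lee_fin !invfM mul1r mulrCA mulfV ?mulr1//.
Qed.

End counting_function.

(** * Extraction of the compact family *)

Section main.
Context {R : realType} {X : completeMetricType R}.
Variable sepX : separable X.
Variables (mu : {measure set (borel X) -> \bar R}) (mu_fin : finite_on_bounded mu).
Variables (p : R) (p1 : 1 <= p) (r : \bar R) (r1 : (1 <= r)%E).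
Variables (f : borel X -> R) (mf : measurable_fun setT f).
Variables (rho : borel X -> \bar R) (mrho : measurable_fun setT rho).
Hypothesis rho0 : forall x, (0 <= rho x)%E.
Local Open Scope ereal_scope.

Let p0 : (0 < p)%R. Proof. exact: lt_le_trans p1. Qed.

Let bad := bad_curves r f rho.

Lemma bad_curves_tame g : bad g -> tame g.
Proof. by move=> [/(AC01_tame r1)]. Qed.

Definition bounded_part (x0 : X) (L : R) : set (R -> X) :=
  [set g | [/\ bad g, (mdist x0 (g 0%R) <= L)%R & (arc_length g 1 <= L)%R]].

(** The bad curves form a countable union of bounded parts. *)
Lemma bounded_part_neq0 (x0 : X) : 0 < Mod1 mu p (curves01 bad) ->
  exists2 L : R, (0 < L)%R & Mod1 mu p (curves01 (bounded_part x0 L)) <> 0.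
Proof.
move=> Mpos; apply: contrapT => H.
suff : Mod1 mu p (curves01 bad) = 0 by move=> M0; rewrite M0 ltxx in Mpos.
apply: (Mod1_eq0_bigcup p1 (Gn := fun n => bounded_part x0 n.+1%:R)).
- by move=> g; exact: bad_curves_tame.
- by move=> n g [/bad_curves_tame].
- move=> g bg.
  pose a := Order.max (mdist x0 (g 0%R)) (arc_length g 1).
  exists (Num.truncn a) => //=; have aN := ltW (Num.Theory.truncnS_gt a).
  by split => //; apply: le_trans aN; rewrite le_max lexx ?orbT.
- by move=> n; apply: contrapT => Mn; apply: H; exists n.+1%:R.
Qed.

(** What is admissible for [G'] is admissible for [G]. *)
Lemma Mod1_eq0_same_integrals (G G' : set (R -> X)) : G `<=` tame -> G' `<=` tame ->
  (forall g, G g -> exists2 g', G' g' & [/\ g' 0%R = g 0%R, g' 1%R = g 1%R &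
     forall sigma : borel X -> \bar R, measurable_fun setT sigma ->
       (forall x, 0 <= sigma x) -> line_integral 0 1 g' sigma = line_integral 0 1 g sigma]) ->
  Mod1 mu p (curves01 G') = 0 -> Mod1 mu p (curves01 G) = 0.
Proof.
move=> Gt G't H G'0; apply/eqP; rewrite eq_le Mod1_ge0 andbT -G'0.
apply: ereal_inf_le_tmp => _ [sigma /(admissible01P _ G't)[ms s0 As] <-].
exists sigma => //; apply/(admissible01P _ Gt); split => // g /H[g' G'g'] [<- <- gE].
by rewrite -gE//; exact: As.
Qed.

Section approximation.
Variables (x0 : X) (L : R).
Hypothesis L0 : (0 < L)%R.

(** A ball that contains all the curves of length at most [L] that start at
    distance at most [L] from [x0]. *)
Let B : set (borel X) := ball x0 (2 * L + 1)%R.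

Let mB : measurable B.
Proof. by apply: sub_sigma_algebra; exact: open_mball. Qed.

Let muB : mu B < +oo.
Proof.
apply: mu_fin => //; exists (2 * (2 * L + 1))%R => x y.
rewrite /B ballEmdist/= => x0x x0y.
apply: le_trans (metric_triangle x x0 y) _; rewrite (metric_sym x x0); lra.
Qed.

Let scale j : R := (j.+1%:R^-1)%R.

Let scale_gt0 j : (0 < scale j)%R. Proof. by rewrite invr_gt0. Qed.

Let le_scale j (x y : \bar R) : x <= y -> (scale j)%:E * x <= (scale j)%:E * y.
Proof. by move=> xy; apply: lee_wpmul2l => //; rewrite lee_fin ltW. Qed.

(** Small enough for [sup_count_integrable]. *)
Let weight j k : R := ((2 ^ j.+1)%:R * (2 ^ k.+1)%:R * k.+1%:R `^ p)^-1.

Let weight_gt0 j k : (0 < weight j k)%R.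
Proof. by rewrite invr_gt0 !mulr_gt0 ?powR_gt0// ltr0n expn_gt0. Qed.

Let E j k : set (borel X) := level_set rho (scale j) k.

Let mE j k : measurable (E j k).
Proof.
rewrite (_ : E j k = setT `&` rho @^-1` `](k%:R * scale j)%:E, +oo[%classic).
  by apply: mrho => //; exact: emeasurable_itv.
by rewrite setTI; apply/seteqP; split => x; rewrite /E /level_set/= in_itv/= andbT.
Qed.

(** The outcome of [compact_open_approximation] at the level [k] of the scale
    [j]. *)
Let approx (K V : nat -> nat -> set X) (D : nat -> nat -> set (borel X)) := forall j k,
  [/\ compact (K j k) /\ {within K j k, continuous (f : X -> R)},
      open (V j k) /\ E j k `<=` V j k, ~` K j k `<=` V j k `&` D j k,
      measurable (D j k) /\ V j k `<=` E j k `|` D j k &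
      mu (D j k `&` B) <= (weight j k)%:E].

Let approx_exists : exists K V D, approx K V D.
Proof.
have nuT : mrestr mu mB setT < +oo by rewrite /= /mrestr setTI.
have ex (jk : nat * nat) : exists KVD : set X * set X * set (borel X),
  [/\ compact KVD.1.1 /\ {within KVD.1.1, continuous (f : X -> R)},
      open KVD.1.2 /\ E jk.1 jk.2 `<=` KVD.1.2, ~` KVD.1.1 `<=` KVD.1.2 `&` KVD.2,
      measurable KVD.2 /\ KVD.1.2 `<=` E jk.1 jk.2 `|` KVD.2 &
      mu (KVD.2 `&` B) <= (weight jk.1 jk.2)%:E].
  have [K [V [D H]]] := compact_open_approximation nuT sepX mf (mE jk.1 jk.2)
    (weight_gt0 jk.1 jk.2).
  by exists (K, V, D).
have [KVD H] := choice ex.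
exists (fun j k => (KVD (j, k)).1.1), (fun j k => (KVD (j, k)).1.2), (fun j k => (KVD (j, k)).2).
by move=> j k; exact: (H (j, k)).
Qed.

Section with_approximation.
Variables (K V : nat -> nat -> set X) (D : nat -> nat -> set (borel X)).
Hypothesis KVD : approx K V D.

Let cK j k : compact (K j k). Proof. by have [[]] := KVD j k. Qed.
Let fK j k : {within K j k, continuous (f : X -> R)}.
Proof. by have [[]] := KVD j k. Qed.
Let oV j k : open (V j k). Proof. by have [_ []] := KVD j k. Qed.
Let EV j k : E j k `<=` V j k. Proof. by have [_ []] := KVD j k. Qed.
Let KV j k : ~` K j k `<=` V j k.
Proof. by have [_ _ H _ _] := KVD j k; move=> x /H[]. Qed.
Let KD j k : ~` K j k `<=` D j k.
Proof. by have [_ _ H _ _] := KVD j k; move=> x /H[]. Qed.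
Let mD j k : measurable (D j k `&` B).
Proof. by have [_ _ _ [mD _] _] := KVD j k; exact: measurableI. Qed.
Let VED j k : V j k `<=` E j k `|` D j k. Proof. by have [_ _ _ []] := KVD j k. Qed.
Let muD j k : mu (D j k `&` B) <= (weight j k)%:E.
Proof. by have [] := KVD j k. Qed.
Let mV j k : measurable (V j k : set (borel X)).
Proof. exact: sub_sigma_algebra. Qed.

(** The common error function of all the scales. *)
Let h := sup_count (fun j k => D j k `&` B).

Let mh : measurable_fun setT h. Proof. exact: measurable_sup_count. Qed.
Let h0 x : 0 <= h x. Proof. exact: sup_count_ge0. Qed.
Let hp : \int[mu]_x (h x `^ p) < +oo.
Proof. exact: sup_count_integrable. Qed.

(** The layer cake sum of [rho] at the scale [j], with open sets in place of the
    level sets. *)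
Let majorant j (x : borel X) : \bar R :=
  (scale j)%:E * \sum_(k <oo) (\1_(V j k) x)%:E.

Let mindic (A : set (borel X)) : measurable A ->
  measurable_fun setT (fun x => (\1_A x)%:E : \bar R).
Proof. by move=> mA; exact/measurable_EFinP/measurable_indic. Qed.

Let msum j : measurable_fun setT (fun x : borel X => \sum_(k <oo) (\1_(V j k) x)%:E : \bar R).
Proof.
apply: ge0_emeasurable_sum => [k x _ _|k _]; first exact: indic_ge0.
exact: mindic.
Qed.

Let sum0 j x : 0 <= \sum_(k <oo) (\1_(V j k) x)%:E :> \bar R.
Proof. by apply: nneseries_ge0 => k _ _; exact: indic_ge0. Qed.

Let mmajorant j : measurable_fun setT (majorant j).
Proof. exact: (@emeasurable_funM _ _ _ setT (cst (scale j)%:E)). Qed.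

Let majorant0 j x : 0 <= majorant j x.
Proof. by rewrite mule_ge0// lee_fin ltW. Qed.

Let le_majorant j x : rho x <= majorant j x.
Proof.
apply: le_trans (level_sum_ge (scale_gt0 j) (rho0 x)) _.
apply: le_scale; apply: lee_nneseries => k _; first by move=> _; exact: indic_ge0.
have [Ex|Ex] := pselect (E j k x); last by rewrite [in leLHS]indicE memNset// indic_ge0.
by rewrite !indicE !mem_set//; exact: EV.
Qed.

Let majorant_le j x : B x -> majorant j x <= rho x + (scale j)%:E * (1 + h x).
Proof.
move=> Bx.
have I0 (A : set (borel X)) : 0 <= (\1_A x)%:E :> \bar R by exact: indic_ge0.
apply: (@le_trans _ _ ((scale j)%:E * (\sum_(k <oo) (\1_(E j k) x)%:E +
    \sum_(k <oo) (\1_(D j k `&` B) x)%:E))).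
  apply: le_scale; rewrite -nneseriesD//.
  apply: lee_nneseries => // k _.
  have [Vx|Vx] := pselect (V j k x); last by rewrite [in leLHS]indicE memNset// adde_ge0.
  have [Ex|Dx] := VED Vx.
    by rewrite [in leLHS]indicE mem_set// [in leRHS]indicE mem_set//= leeDl.
  have -> : (\1_(D j k `&` B) x)%:E = 1 :> \bar R by rewrite indicE mem_set.
  by rewrite [in leLHS]indicE mem_set//= leeDr.
rewrite ge0_muleDr ?nneseries_ge0//.
rewrite ge0_muleDr// mule1 addeA; apply: leeD; first exact: level_sum_le.
by apply: le_scale; exact: (sup_count_ge (fun j k => D j k `&` B)).
Qed.

Let family j k : set (R -> X) := tight_family f x0 L (scale j) (K j k) (V j).

Let family_tame j k : family j k `<=` tame.
Proof. by move=> g; exact: tight_family_tame. Qed.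

Let line_majorant j g : tame g -> line_integral 0 1 g (majorant j) =
  (scale j)%:E * \sum_(k <oo) length_in g (V j k).
Proof.
move=> tg; rewrite line_integralZ//; last exact: ltW.
by rewrite line_integral_indic_sum.
Qed.

(** The majorant is at least [rho], and the margin [scale j] restores the strict
    inequality. *)
Let family_bad j k : family j k `<=` bad.
Proof.
move=> g Fg; have tg := family_tame Fg; have [gc gL gx _ gV] := Fg.
split; first exact: (lipschitz_AC01 r1 (ltW L0) gL).
apply: (@le_lt_trans _ _ (line_integral 0 1 g (majorant j))).
  by apply: le_line_integral.
rewrite line_majorant// -nneseriesZl; last by move=> i _; exact: measure_ge0.
apply: (@le_lt_trans _ _ (`|f (g 1%R) - f (g 0%R)| - scale j)%:E); last first.
  by rewrite lte_fin ltrBlDr ltrDl.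
apply: lime_le.
  by apply: is_cvg_nneseries => i _ _; rewrite mule_ge0 ?measure_ge0// lee_fin ltW.
apply: nearW => m; have := gV m; rewrite -lerBrDr -lee_fin.
rewrite EFinM -sumEFin ge0_sume_distrr; last by move=> i _; rewrite lee_fin fine_ge0// measure_ge0.
rewrite big_mkord; apply: le_trans; apply: lee_sum => i _.
by rewrite fineK// length_in_fin.
Qed.

(** The curves start in [B], so the indicator of [B] is admissible. *)
Let family_Mod1_lty j k : Mod1 mu p (curves01 (family j k)) < +oo.
Proof.
apply: (@le_lt_trans _ _ (\int[mu]_x ((\1_B x)%:E `^ p))).
  apply: Mod1_le; apply/admissible01P; first exact: family_tame.
  split; [exact: mindic|by move=> x; exact: indic_ge0|].
  move=> g Fg; have [_ _ gx _ _] := Fg.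
  rewrite {1}indicE mem_set/=; last first.
    rewrite /B ballEmdist/=; apply: le_lt_trans gx _.
    by have := L0; lra.
  rewrite -addeA leeDl// adde_ge0 ?indic_ge0// line_integral_ge0//.
  exact: (family_tame Fg).
rewrite (eq_integral (fun x => (\1_B x)%:E)); last first.
  move=> x _; rewrite !indicE poweR_EFin; congr (_%:E).
  by case: (_ \in _); rewrite /= ?powR1// powR0// gt_eqF.
by rewrite integral_indic// setIT.
Qed.

Let family_lipschitz j k :
  family j k `<=` LIP01 `&` [set g | lip01 g <= L%:E].
Proof.
move=> g Fg; have lipL : lip01 g <= L%:E.
  apply: ge_ereal_sup => _ [[s t] /= [_ _ st] <-].
  rewrite lee_fin ler_pdivrMr ?normr_gt0 ?subr_eq0//.
  exact: (tight_family_lipschitz L0 s t Fg).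
by split => //=; exact: le_lt_trans lipL (ltry _).
Qed.

(** Along such a curve the majorant at the scale [j] costs at most [scale j] times
    the finite constant [A] more than [rho]. For large [j] this is absorbed by the
    gap in the strict inequality that defines bad curves. The end points lie in
    [K j k] for all but finitely many [k], as [h] is finite there. *)
Let bounded_part_cover g : bounded_part x0 L g ->
  h (g 0%R) + h (g 1%R) + line_integral 0 1 g h < +oo ->
  exists j k g', family j k g' /\ [/\ g' 0%R = g 0%R, g' 1%R = g 1%R &
     forall sigma : borel X -> \bar R, measurable_fun setT sigma ->
       (forall x, 0 <= sigma x) -> line_integral 0 1 g' sigma = line_integral 0 1 g sigma].
Proof.
move=> [bg gx gl] hfin; have tg := bad_curves_tame bg.
have [_ gap] := bg.
have ih0 : 0 <= line_integral 0 1 g h by exact: line_integral_ge0.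
have ir0 : 0 <= line_integral 0 1 g rho by exact: line_integral_ge0.
have h0fin : h (g 0%R) < +oo.
  by apply: le_lt_trans hfin; rewrite -addeA leeDl// adde_ge0.
have h1fin : h (g 1%R) < +oo.
  by apply: le_lt_trans hfin; rewrite addeAC leeDr// adde_ge0.
have ihfin : line_integral 0 1 g h \is a fin_num.
  by rewrite ge0_fin_numE//; apply: le_lt_trans hfin; rewrite leeDr// adde_ge0.
have irfin : line_integral 0 1 g rho \is a fin_num.
  by rewrite ge0_fin_numE//; apply: lt_le_trans gap (leey _).
(* A bad curve is not constant. *)
have l0 : (0 < arc_length g 1)%R.
  rewrite lt_neqAle -{2}(arc_length0 g) arc_length_nd ?ler01// andbT.
  apply/negP => /eqP l0; move: gap.
  have : (mdist (g 0) (g 1) <= 0)%R.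
    apply: le_trans (mdist_le_arc_length tg _ _) _; rewrite ?lexx ?ler01//.
    by rewrite arc_length0 -l0 subrr normr0.
  move=> d0; have -> : g 1%R = g 0%R.
    by apply/esym/mdist_positivity/eqP; rewrite eq_le d0 mdist_ge0.
  by rewrite subrr normr0 ltNge ir0.
have gB t : (0 <= t)%R -> (t <= 1)%R -> B (g t).
  move=> t0 t1; rewrite /B ballEmdist/=.
  have ht : (mdist (g 0) (g t) <= L)%R.
    apply: le_trans (mdist_le_arc_length tg _ _) _; rewrite ?lexx ?ler01 ?t0 ?t1//.
    rewrite arc_length0 sub0r normrN ger0_norm; last first.
      by rewrite -(arc_length0 g) arc_length_nd.
    exact: le_trans (arc_length_nd tg t1) gl.
  apply: le_lt_trans (metric_triangle x0 (g 0%R) (g t)) _.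
  apply: le_lt_trans (lerD gx ht) _; lra.
pose A : R := (arc_length g 1 + fine (line_integral 0 1 g h))%R.
have A0 : (0 <= A)%R by rewrite addr_ge0 ?(ltW l0)// fine_ge0.
pose Delta : R := (`|f (g 1%R) - f (g 0%R)| - fine (line_integral 0 1 g rho))%R.
have D0 : (0 < Delta)%R by rewrite subr_gt0 -lte_fin fineK.
have [j jD] : exists j, (scale j * (A + 1) < Delta)%R.
  have A10 : (0 < A + 1)%R by rewrite ltr_wpDl.
  have [j] := ltr_add_invr (divr_gt0 D0 A10); rewrite add0r => jD.
  by exists j; rewrite -ltr_pdivlMr.
have imaj : line_integral 0 1 g (majorant j) <=
    (`|f (g 1%R) - f (g 0%R)| - scale j)%:E.
  apply: (@le_trans _ _ (line_integral 0 1 g (fun x => rho x + (scale j)%:E * (1 + h x)))).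
    apply: le_line_integral => //; last by move=> t t0 t1; exact/majorant_le/gB.
    apply: emeasurable_funD => //.
    apply: (@emeasurable_funM _ _ _ setT (cst (scale j)%:E)) => //.
    exact: emeasurable_funD.
  have m1h : measurable_fun setT (fun x => 1 + h x) by exact: emeasurable_funD.
  have p1h x : 0 <= 1 + h x by rewrite adde_ge0.
  rewrite line_integralD//; last 2 first.
    exact: (@emeasurable_funM _ _ _ setT (cst (scale j)%:E)).
    by move=> x; rewrite mule_ge0// lee_fin ltW.
  rewrite line_integralZ//; last exact: ltW.
  rewrite (line_integralD (rho := cst 1))//.
  rewrite line_integral_cst1// -arc_lengthB// arc_length0 subr0.
  rewrite -(fineK ihfin) -(fineK irfin) -(EFinD (arc_length g 1)) -(EFinM (scale j)).
  rewrite -EFinD lee_fin.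
  move: jD; rewrite /Delta /A mulrDr mulr1; lra.
have [N0 HN0] : exists N, forall k, (N <= k)%N -> ~ (D j k `&` B) (g 0%R).
  apply: (@indic_sum_fin_eventually_notin R X (fun k => D j k `&` B)); apply: le_lt_trans h0fin.
  exact: (sup_count_ge (fun j k => D j k `&` B)).
have [N1 HN1] : exists N, forall k, (N <= k)%N -> ~ (D j k `&` B) (g 1%R).
  apply: (@indic_sum_fin_eventually_notin R X (fun k => D j k `&` B)); apply: le_lt_trans h1fin.
  exact: (sup_count_ge (fun j k => D j k `&` B)).
have [g' [g'c g'L g'0 g'1 g'I]] := constant_speed tg l0.
have tg' : tame g' by exact: lipschitz_tame g'L.
exists j, (maxn N0 N1), g'; split => //; split => //.
- move=> s t s0 st t1; apply: le_trans (g'L s t s0 st t1) _.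
  by rewrite ler_wpM2r ?subr_ge0.
- by rewrite g'0.
- rewrite g'0 g'1; split; apply: contrapT => /KD Dg.
    by apply: (HN0 _ (leq_maxl N0 N1)); split => //; exact: gB.
  by apply: (HN1 _ (leq_maxr N0 N1)); split => //; exact: gB.
- move=> m; rewrite g'0 g'1 -lerBrDr -lee_fin; apply: le_trans imaj.
  rewrite -g'I// line_majorant// EFinM; apply: le_scale.
  rewrite -sumEFin; apply: le_trans (nneseries_lim_ge m _); last first.
    by move=> i _ _; exact: measure_ge0.
  by rewrite big_mkord; apply: lee_sum => i _; rewrite fineK// length_in_fin.
Qed.

Let family_exists : Mod1 mu p (curves01 (bounded_part x0 L)) <> 0 ->
  exists j k, Mod1 mu p (curves01 (family j k)) <> 0.
Proof.
move=> M0; apply: contrapT => H; apply: M0.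
have F0 j k : Mod1 mu p (curves01 (family j k)) = 0.
  by apply: contrapT => Fn; apply: H; exists j, k.
pose same g g' := [/\ g' 0%R = g 0%R, g' 1%R = g 1%R &
  forall sigma : borel X -> \bar R, measurable_fun setT sigma ->
    (forall x, 0 <= sigma x) -> line_integral 0 1 g' sigma = line_integral 0 1 g sigma].
pose Z := [set g | bounded_part x0 L g /\
  h (g 0%R) + h (g 1%R) + line_integral 0 1 g h = +oo].
pose P j k := [set g | bounded_part x0 L g /\ exists2 g', family j k g' & same g g'].
pose PP j := \bigcup_k P j k.
have bt : bounded_part x0 L `<=` tame by move=> g [/bad_curves_tame].
have P0 j k : Mod1 mu p (curves01 (P j k)) = 0.
  apply: Mod1_eq0_same_integrals (F0 j k).
  - by move=> g [/bt].
  - exact: family_tame.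
  - by move=> g [_ [g' Fg' gg']]; exists g'.
have PP0 j : Mod1 mu p (curves01 (PP j)) = 0.
  apply: (Mod1_eq0_bigcup p1 (Gn := P j)) => //.
  - by move=> g [k _ [/bt]].
  - by move=> k g [/bt].
apply: (Mod1_eq0_bigcup p1 (Gn := fun m => if m is j.+1 then PP j else Z)) => //.
- by case=> [|j] g; [move=> [/bt]|move=> [k _ [/bt]]].
- move=> g bg.
  have [hoo|hfin] := eqVneq (h (g 0%R) + h (g 1%R) + line_integral 0 1 g h) +oo.
    by exists 0%N.
  have [|j [k [g' [Fg' gg']]]] := bounded_part_cover bg.
    by rewrite lt_neqAle hfin leey.
  by exists j.+1 => //; exists k => //; split => //; exists g'.
- case=> [|j]; last exact: PP0.
  apply: (Mod1_eq0_infinite p1 _ mh h0 hp); first by move=> g [/bt].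
  by move=> g [].
Qed.

Lemma approximation_compact_family : Mod1 mu p (curves01 (bounded_part x0 L)) <> 0 ->
  exists G : set (R -> X),
    [/\ compact01 G, G `<=` bad, 0 < Mod1 mu p (curves01 G) < +oo &
        G `<=` LIP01 `&` [set g | lip01 g <= L%:E]].
Proof.
move=> /family_exists[j [k Fjk]]; exists (family j k); split.
- exact: (tight_family_compact L0 (scale_gt0 j) (@cK j k) (@fK j k) (oV j) (@cK j) (@KV j)).
- exact: family_bad.
- by rewrite family_Mod1_lty andbT lt_neqAle Mod1_ge0 andbT eq_sym; apply/eqP.
- exact: family_lipschitz.
Qed.

End with_approximation.

Lemma bounded_part_compact_family : Mod1 mu p (curves01 (bounded_part x0 L)) <> 0 ->
  exists G : set (R -> X),
    [/\ compact01 G, G `<=` bad, 0 < Mod1 mu p (curves01 G) < +oo &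
        G `<=` LIP01 `&` [set g | lip01 g <= L%:E]].
Proof.
by have [K [V [D KVD]]] := approx_exists; exact: approximation_compact_family KVD.
Qed.

End approximation.

End main.

Theorem lemma3p21 (R : realType) (X : completeMetricType R)
  (sepX : separable X)
  (mu : {measure set (borel X) -> \bar R}) (mu_fin : finite_on_bounded mu)
  (p : R) (p1 : 1 <= p) (r : \bar R) (r1 : (1 <= r)%E)
  (f : borel X -> R) (mf : measurable_fun setT f)
  (fp : (\int[mu]_x (`|f x| `^ p)%:E < +oo)%E)
  (rho : borel X -> \bar R) (mrho : measurable_fun setT rho)
  (rho0 : forall x, (0 <= rho x)%E)
  (rhop : (\int[mu]_x (rho x `^ p) < +oo)%E)
  (Mpos : (0 < Mod1 mu p (curves01 (bad_curves r f rho)))%E) :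
  exists (G : set (R -> X)) (k : R),
    [/\ 0 < k,
        compact01 G,
        G `<=` bad_curves r f rho,
        (0 < Mod1 mu p (curves01 G) < +oo)%E &
        G `<=` LIP01 `&` [set g | (lip01 g <= k%:E)%E]].
Proof.
have [L L0 M0] := bounded_part_neq0 p1 r1 (point : X) Mpos.
have [G [cG Gbad GM GL]] :=
  bounded_part_compact_family sepX mu_fin p1 r1 mf mrho rho0 L0 M0.
by exists G, L; split.
Qed.
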